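(* Let $1<a_1<a_2$ be coprime integers and let $S=\langle a_1,a_2\rangle=\{\lambda_1a_1+\lambda_2a_2:\lambda_1,\lambda_2\in\mathbb{N}_0\}$. Let $\mathcal{P}\subseteq(1,\infty)$ be the set of perspicacious parameters $t$ for $S$, and let $r_0^{-1}(\mathbb{Q})=\{t\in[1,\infty]: r_0(t)\in\mathbb{Q}\}$. Then $\mathcal{P}\subseteq r_0^{-1}(\mathbb{Q})$, $\mathcal{P}$ is countable, and there exists $T$ such that $\mathcal{P}$ is dense in the ray $(T,\infty)$, i.e. $(T,\infty)$ is contained in the closure of $\mathcal{P}$.
   Context: For $t\in[1,\infty)$ and $(u,v)\in\mathbb{R}^2$, $\|(u,v)\|_t=(|u|^t+|v|^t)^{1/t}$, and $\|(u,v)\|_\infty=\max(|u|,|v|)$. For $x\in S$, the factorization set is $Z(x)=\{(m,n)\in\mathbb{N}_0^2: ma_1+na_2=x\}$ (a finite set), the $t$-length set is $\mathscr{L}_t(x)=\{\|f\|_t: f\in Z(x)\}$, $\Delta_t(x)$ is the set of differences between consecutive elements of $\mathscr{L}_t(x)$ (listed in increasing order), and $\Delta_t(S)=\bigcup_{x\in S}\Delta_t(x)$. A parameter $t\in(1,\infty)$ is called dull if $\Delta_t(S)$ is dense in $[0,a_2]$ (i.e. $[0,a_2]$ is contained in the closure of $\Delta_t(S)$), and perspicacious otherwise. Define $\mu(r,t)=\left\|\left(\frac{1-r}{a_1},\frac{r}{a_2}\right)\right\|_t$ for $r\in[0,1]$, $t\in[1,\infty]$, write $\mu_t(r)=\mu(r,t)$,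 and set $r_0(t)=\min\{r\in[0,1]:\mu_t(r)=\frac{1}{a_2}\}$. *)

(* Defs.v *)
From mathcomp Require Import all_boot all_order all_algebra.
From mathcomp Require Import all_classical all_reals all_analysis.
Set Implicit Arguments. Unset Strict Implicit. Unset Printing Implicit Defensive.
Import Order.TTheory GRing.Theory Num.Theory numFieldNormedType.Exports.
Local Open Scope classical_set_scope.
Local Open Scope ring_scope.

Section Defs.
Variable R : realType.

Definition tnorm (t u v : R) : R := (`|u| `^ t + `|v| `^ t) `^ t^-1.

Definition Zfact (a1 a2 x : nat) : set (nat * nat) :=
  [set f | (f.1 * a1 + f.2 * a2)%N = x].

Definition Lset (a1 a2 : nat) (t : R) (x : nat) : set R :=
  (fun f : nat * nat => tnorm t f.1%:R f.2%:R) @` Zfact a1 a2 x.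

Definition Delta_x (a1 a2 : nat) (t : R) (x : nat) : set R :=
  [set d | exists l1 l2, [/\ Lset a1 a2 t x l1, Lset a1 a2 t x l2, l1 < l2,
      d = l2 - l1 & forall l, Lset a1 a2 t x l -> ~ (l1 < l < l2)]].

Definition Delta_S (a1 a2 : nat) (t : R) : set R :=
  \bigcup_(x in [set x : nat | exists l1 l2 : nat, x = (l1 * a1 + l2 * a2)%N])
    Delta_x a1 a2 t x.

Definition dull (a1 a2 : nat) (t : R) : Prop :=
  1 < t /\ [set x : R | 0 <= x <= a2%:R] `<=` closure (Delta_S a1 a2 t).

Definition perspicacious (a1 a2 : nat) (t : R) : Prop :=
  1 < t /\ ~ [set x : R | 0 <= x <= a2%:R] `<=` closure (Delta_S a1 a2 t).

Definition mu (a1 a2 : nat) (r t : R) : R :=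
  tnorm t ((1 - r) / a1%:R) (r / a2%:R).

(* r_0(t) = min {r in [0,1] : mu_t(r) = 1/a2}; the set is closed and contains 1,
   so its infimum is its minimum *)
Definition r0 (a1 a2 : nat) (t : R) : R :=
  inf [set r : R | 0 <= r <= 1 /\ mu a1 a2 r t = a2%:R^-1].

End Defs.

(* Main.v *)
(* A factorization (m, n) of x corresponds to the point r = n a2 / x of [0, 1], and its
   t-length is x mu_t(r). Consecutive points are a1 a2 / x apart and mu_t is convex, so the
   lengths of neighbouring points differ by a1 a2 times a slope of mu_t, up to o(1). Let rho = r_0(t) and
   c = - a1 a2 mu_t'(rho). Lengths above x / a2 come only from points left of rho, which already
   gives gaps dense in [c, a2].

   If rho is irrational, take x = n a2: the length x / a2 of the point 1 is followed by the
   length of the last point left of rho, whose offset to rho is governed by n (1 - rho) / a1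
   modulo 1; by Kronecker's theorem these gaps are dense in [0, c]. Hence t is dull.

   If rho is rational and a1 < c, a gap in ]a1, c[ must start, for x large, at the largest
   length of the right branch (gaps below it are at most a1, other gaps above it are at least
   c up to o(1)), and rationality leaves only finitely many limit values for it. Hence t is
   perspicacious.

   Finally r_0 is strictly decreasing, which gives countability, and takes rational values
   densely by the intermediate value theorem in t, while c tends to a2 > a1 as t grows. *)
Require Import Defs.
From mathcomp Require Import all_boot all_order all_algebra.
From mathcomp Require Import all_classical all_reals all_analysis.
From mathcomp Require Import zify ring lra.
Import Order.TTheory GRing.Theory Num.Theory numFieldNormedType.Exports.
Local Open Scope classical_set_scope.
Local Open Scope ring_scope.
Set Implicit Arguments. Unset Strict Implicit. Unset Printing Implicit Defensive.

(** * The norm profile and its subgradient *)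

(** Away from 0 the function is [expR (p * ln |x|)]. At 0 that formula breaks down, and the ball of
    radius [e] to the power [1 / p] is used directly. *)
Lemma norm_powR_continuous (R : realType) (p : R) : 0 < p ->
  continuous (fun x : R => `|x| `^ p).
Proof.
move=> p0 x; have [->|x0] := eqVneq x 0.
  apply/cvgrPdist_lt => e e0.
  have ep : 0 < e `^ p^-1 by rewrite powR_gt0.
  apply: (filterS _ (@nbhs0_lt R R^o _ ep)) => y /= ye.
  rewrite normr0 powR0 ?gt_eqF// sub0r normrN ger0_norm ?powR_ge0//.
  have -> : e = (e `^ p^-1) `^ p by rewrite -powRrM mulVf ?gt_eqF// powRr1 ?ltW.
  by apply: gt0_ltr_powR => //; rewrite nnegrE ?ltW.
apply: (@cvg_trans _ ((fun y : R => expR (p * ln `|y|)) @ nbhs x)).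
  apply: near_eq_cvg.
  have : \forall y \near x, y != 0.
    have := @open_nbhs_nbhs R x [set y | y != 0]; apply.
    by split => //; exact: open_neq.
  by apply: filterS => y y0; rewrite /powR normr_eq0 (negPf y0).
have -> : `|x| `^ p = expR (p * ln `|x|) by rewrite /powR normr_eq0 (negPf x0).
apply: (@continuous_cvg _ _ _ _ _ _ (@expR R)); first exact: continuous_expR.
apply: cvgMl_tmp => //.
apply: (@continuous_cvg _ _ _ _ _ _ (@ln R)); first by apply: continuous_ln; rewrite normr_gt0.
exact: cvg_norm.
Qed.

Lemma tnorm_gt0 (R : realType) (t u v : R) : (u != 0) || (v != 0) -> 0 < tnorm t u v.
Proof.
rewrite /tnorm => uv; apply: powR_gt0.
have pge0 (x : R) : 0 <= `|x| `^ t by rewrite powR_ge0.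
case/orP: uv => h.
- by rewrite ltr_wpDr// powR_gt0 ?normr_gt0.
- by rewrite ltr_wpDl// powR_gt0 ?normr_gt0.
Qed.

Lemma tnormZ (R : realType) (t k u v : R) : 0 < t -> 0 <= k ->
  tnorm t (k * u) (k * v) = k * tnorm t u v.
Proof.
move=> t0 k0; rewrite /tnorm !normrM !powRM// -mulrDr powRM ?powR_ge0 ?addr_ge0 ?powR_ge0//.
by rewrite -powRrM mulfV ?gt_eqF// powRr1// ger0_norm.
Qed.

Lemma tnorm_powR (R : realType) (t u v : R) : 0 < t ->
  (tnorm t u v) `^ t = `|u| `^ t + `|v| `^ t.
Proof.
move=> t0; rewrite /tnorm -powRrM mulVf ?gt_eqF// powRr1//.
Qed.

(** Hölder's inequality with exponents [t] and [t / (t - 1)]: raised to the second, the entries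
    [u ^ (t - 1)] and [v ^ (t - 1)] become [u ^ t] and [v ^ t], whose sum is 1. *)
Lemma tnorm_dual (R : realType) (t u v u' v' : R) : 1 < t ->
  0 <= u -> 0 <= v -> 0 <= u' -> 0 <= v' -> tnorm t u v = 1 ->
  u' * u `^ (t - 1) + v' * v `^ (t - 1) <= tnorm t u' v'.
Proof.
move=> t1 u0 v0 u'0 v'0 N1; have t0 : 0 < t by lra.
have t10 : 0 < t - 1 by lra.
have q0 : 0 < t / (t - 1) by rewrite divr_gt0.
have pq : t^-1 + (t / (t - 1))^-1 = 1 by field; rewrite !gt_eqF.
have := @hoelder2 _ u' v' (u `^ (t - 1)) (v `^ (t - 1)) _ _
  u'0 v'0 (powR_ge0 _ _) (powR_ge0 _ _) t0 q0 pq.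
rewrite -!powRrM.
have -> : (t - 1) * (t / (t - 1)) = t by field; rewrite gt_eqF.
have -> : u `^ t + v `^ t = 1.
  by have := @tnorm_powR _ t u v t0; rewrite N1 powR1 !ger0_norm.
by rewrite powR1 mulr1 /tnorm !ger0_norm.
Qed.

Section Mu.
Variables (R : realType) (a1 a2 : nat) (t : R).
Hypotheses (a1_gt0 : (0 < a1)%N) (a2_gt0 : (0 < a2)%N) (t_gt1 : 1 < t).
Local Notation mu r := (mu a1 a2 r t).

(* The derivative of mu in r, with absolute values so that it is continuous on the whole line.
   Being a subgradient, by Hoelder, is all that is needed: mu is never differentiated. *)
Definition dmu (r : R) : R :=
  `|r / a2%:R / mu r| `^ (t - 1) / a2%:R
  - `|(1 - r) / a1%:R / mu r| `^ (t - 1) / a1%:R.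

Let A1 : 0 < a1%:R :> R. Proof. by rewrite ltr0n. Qed.
Let A2 : 0 < a2%:R :> R. Proof. by rewrite ltr0n. Qed.
Let t0 : 0 < t. Proof. exact: lt_trans t_gt1. Qed.
Let t10 : 0 < t - 1. Proof. by rewrite subr_gt0. Qed.

Lemma mu_gt0 r : 0 < mu r.
Proof.
have nz (x a : R) : 0 < a -> (x / a == 0) = (x == 0).
  by move=> a0; rewrite mulf_eq0 invr_eq0 (gt_eqF a0) orbF.
apply: tnorm_gt0; rewrite !nz//.
by have [->|_] := eqVneq r 0; rewrite ?orbT ?subr0 ?oner_neq0.
Qed.

Lemma mu_at0 : mu 0 = a1%:R^-1.
Proof.
rewrite /Defs.mu /tnorm subr0 mul0r normr0 powR0 ?gt_eqF// addr0 -powRrM.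
by rewrite mulfV ?gt_eqF// powRr1// mul1r ger0_norm// invr_ge0 ltW.
Qed.

Lemma mu_at1 : mu 1 = a2%:R^-1.
Proof.
rewrite /Defs.mu /tnorm subrr mul0r normr0 powR0 ?gt_eqF// add0r -powRrM.
by rewrite mulfV ?gt_eqF// powRr1// mul1r ger0_norm// invr_ge0 ltW.
Qed.

Lemma dmu_at0 : dmu 0 = - a1%:R^-1.
Proof.
rewrite /dmu mu_at0 subr0 !mul0r normr0 powR0 ?gt_eqF// mul0r sub0r.
by rewrite mul1r divff ?invr_eq0 ?gt_eqF// normr1 powR1 mul1r.
Qed.

Lemma dmu_at1 : dmu 1 = a2%:R^-1.
Proof.
rewrite /dmu mu_at1 subrr !mul0r normr0 powR0 ?gt_eqF// mul0r subr0.
by rewrite mul1r divff ?invr_eq0 ?gt_eqF// normr1 powR1 mul1r.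
Qed.

Lemma mu_continuous : continuous (fun r => mu r).
Proof.
move=> r; rewrite /Defs.mu /tnorm.
(* The sum is nonnegative, so an absolute value may be put around it to reach the form of
   [norm_powR_continuous]. *)
have -> : (fun r0 : R => (`|(1 - r0) / a1%:R| `^ t + `|r0 / a2%:R| `^ t) `^ t^-1)
  = (fun x => `|x| `^ t^-1) \o
    (fun r0 : R => `|(1 - r0) / a1%:R| `^ t + `|r0 / a2%:R| `^ t).
  by apply/funext => x /=; rewrite (@ger0_norm _ (_ + _)) ?addr_ge0 ?powR_ge0.
apply: continuous_comp; last by apply: norm_powR_continuous; rewrite invr_gt0.
apply: cvgD.
- apply: (@continuous_comp _ _ _ (fun r0 : R => (1 - r0) / a1%:R)
    (fun x => `|x| `^ t)); last exact: norm_powR_continuous.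
  by apply: cvgMr_tmp; apply: cvgB => //; exact: cvg_cst.
- apply: (@continuous_comp _ _ _ (fun r0 : R => r0 / a2%:R)
    (fun x => `|x| `^ t)); last exact: norm_powR_continuous.
  by apply: cvgMr_tmp.
Qed.

Lemma dmu_continuous : continuous dmu.
Proof.
have muV : continuous (fun r => (mu r)^-1).
  by move=> r; apply: cvgV; [rewrite gt_eqF// mu_gt0 | exact: mu_continuous].
move=> r; rewrite /dmu; apply: cvgB; apply: cvgMr_tmp.
- apply: (@continuous_comp _ _ _ (fun r : R => r / a2%:R / mu r)
    (fun x => `|x| `^ (t - 1))); last exact: norm_powR_continuous.
  by apply: cvgM; [apply: cvgMr_tmp | exact: muV].
- apply: (@continuous_comp _ _ _ (fun r : R => (1 - r) / a1%:R / mu r)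
    (fun x => `|x| `^ (t - 1))); last exact: norm_powR_continuous.
  by apply: cvgM; [apply: cvgMr_tmp; apply: cvgB => //; exact: cvg_cst | exact: muV].
Qed.

(** Duality is applied at the normalized vector [(u, v)] of [s]. The resulting lower bound for
    [mu r] is affine in [r] with slope [dmu s], and it is an equality at [r = s]. *)
Lemma dmu_subgradient (r s : R) : 0 <= r <= 1 -> 0 <= s <= 1 ->
  dmu s * (r - s) <= mu r - mu s.
Proof.
move=> /andP[r0 r1] /andP[s0 s1]; have N0 := mu_gt0 s.
set N := mu s in N0 *; pose u := (1 - s) / a1%:R / N; pose v := s / a2%:R / N.
have u0 : 0 <= u by rewrite /u !divr_ge0 ?subr_ge0// ltW.
have v0 : 0 <= v by rewrite /v !divr_ge0 ?subr_ge0// ltW.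
have N1 : tnorm t u v = 1.
  by rewrite /u /v ![_ / N]mulrC tnormZ ?invr_ge0 ?ltW// mulVf// gt_eqF.
have u'0 : 0 <= (1 - r) / a1%:R by rewrite divr_ge0 ?subr_ge0// ltW.
have v'0 : 0 <= r / a2%:R by rewrite divr_ge0 ?subr_ge0// ltW.
have := @tnorm_dual _ t u v _ _ t_gt1 u0 v0 u'0 v'0 N1.
rewrite -/(mu r).
have : u * u `^ (t - 1) + v * v `^ (t - 1) = 1.
  rewrite !mulr_powRB1//.
  by have := @tnorm_powR _ t u v t0; rewrite N1 powR1 !ger0_norm.
rewrite /dmu -/N -/u -/v !ger0_norm//.
move: (u `^ (t - 1)) (v `^ (t - 1)) => p q E.
have NE : N = (1 - s) / a1%:R * p + s / a2%:R * q.
  transitivity (N * (u * p + v * q)); first by rewrite E mulr1.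
  by rewrite /u /v; field; rewrite !gt_eqF.
move=> H; rewrite NE -subr_ge0; move: H; rewrite -subr_ge0; congr (0 <= _).
by field; rewrite !gt_eqF.
Qed.

End Mu.

(** * Abstract convex profiles and their crossing of the level 1 / a2 *)

Lemma continuous_eps_delta (R : realType) (f : R -> R) (s e : R) :
  continuous f -> 0 < e ->
  exists2 d, 0 < d & forall r, `|r - s| < d -> `|f r - f s| < e.
Proof.
move=> fc e0; have /cvgrPdist_lt/(_ e e0) := fc s.
move=> /nbhs_normP[d /= d0 H]; exists d => // r rd.
by rewrite distrC; apply: H; rewrite /= distrC.
Qed.

(* The gap analysis uses mu_t only through these properties. *)
Record profile (R : realType) (a1 a2 : nat) (f df : R -> R) : Prop := Profile {
  profile_sub : forall r s, 0 <= r <= 1 -> 0 <= s <= 1 ->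
    df s * (r - s) <= f r - f s;
  profile_cont : continuous f;
  profile_dcont : continuous df;
  profile_at0 : f 0 = a1%:R^-1;
  profile_at1 : f 1 = a2%:R^-1;
  profile_dat0 : df 0 = - a1%:R^-1;
  profile_dat1 : df 1 = a2%:R^-1 }.

Lemma mu_profile (R : realType) (a1 a2 : nat) (t : R) :
  (0 < a1)%N -> (0 < a2)%N -> 1 < t ->
  profile a1 a2 (fun r => mu a1 a2 r t) (dmu a1 a2 t).
Proof.
move=> a1_gt0 a2_gt0 t_gt1; split.
- exact: dmu_subgradient.
- exact: mu_continuous.
- exact: dmu_continuous.
- exact: mu_at0.
- exact: mu_at1.
- exact: dmu_at0.
- exact: dmu_at1.
Qed.

(** The upper bound stops short of 1, where a profile returns to the level [1 / a2]. *)
Record crossing (R : realType) (a2 : nat) (f df : R -> R) (rho : R) : Prop :=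
  Crossing {
  crossing_itv : 0 < rho < 1;
  crossing_eq : f rho = a2%:R^-1;
  crossing_dlt0 : df rho < 0;
  crossing_gt : forall r, 0 <= r -> r < rho -> a2%:R^-1 < f r;
  crossing_lt : forall r, rho < r -> r < 1 -> f r < a2%:R^-1 }.

Section Crossing.
Variables (R : realType) (a1 a2 : nat) (f df : R -> R).
Hypotheses (a1_gt0 : (0 < a1)%N) (a12 : (a1 < a2)%N).
Hypothesis prof : profile a1 a2 f df.

Let a2_gt0 : (0 < a2)%N. Proof. exact: leq_trans a12. Qed.
Let A1 : 0 < a1%:R :> R. Proof. by rewrite ltr0n. Qed.
Let A2 : 0 < a2%:R :> R. Proof. by rewrite ltr0n. Qed.
Let sub := profile_sub prof.
Let f1 := profile_at1 prof.

(** Adding the subgradient inequalities at [s] and at [r] cancels the values of [f]. *)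
Lemma profile_dhomo (s r : R) : 0 <= s -> s <= r -> r <= 1 -> df s <= df r.
Proof.
move=> s0; rewrite le_eqVlt => /predU1P[->//|sr] r1.
have h1 : df s * (r - s) <= f r - f s by apply: sub; lra.
have h2 : df r * (s - r) <= f s - f r by apply: sub; lra.
have rs : 0 < r - s by lra.
rewrite -(ler_pM2r rs); lra.
Qed.

(** Otherwise the slope at [r] would be positive, seen from [s], and nonpositive, seen from [r']. *)
Lemma profile_lt_right (s r r' : R) : 0 <= s -> s < r -> r < r' -> r' <= 1 ->
  f s < f r' -> f r < f r'.
Proof.
move=> s0 sr rr' r'1 fs; rewrite ltNge; apply/negP => h.
have h1 : df r * (s - r) <= f s - f r by apply: sub; lra.
have h2 : df r * (r' - r) <= f r' - f r by apply: sub; lra.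
have : df r <= 0 by rewrite -(@ler_pM2r _ (r' - r)) ?subr_gt0// mul0r; lra.
have : 0 < df r by rewrite -(@ltr_nM2r _ (s - r)) ?subr_lt0// mul0r; lra.
lra.
Qed.

(** The slope at 1 is positive, hence so is the slope at points close to 1, and the profile climbs
    from there to its value at 1. *)
Lemma exists_below : exists2 s, 0 < s < 1 & f s < a2%:R^-1.
Proof.
have i0 : 0 < a2%:R^-1 :> R by rewrite invr_gt0.
have [d d0 Hd] := @continuous_eps_delta _ _ 1 _ (profile_dcont prof) i0.
have [s s01 sd] : exists2 s, 0 < s < 1 & `|s - 1| < d.
  have [dl|dg] := ltP d 1.
    by exists (1 - d / 2); [lra | rewrite ltr_norml; lra].
  by exists (2^-1); [lra | rewrite ltr_norml; lra].
exists s => //; have := Hd _ sd; rewrite (profile_dat1 prof) ltr_norml => /andP[Ds _].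
have : df s * (1 - s) <= f 1 - f s by apply: sub; lra.
have : 0 < df s * (1 - s) by rewrite mulr_gt0; lra.
rewrite f1; lra.
Qed.

(** The intermediate value theorem applies between 0, where the value is [1 / a1], and a point [s]
    below the level. The descent from [rho] to [s] forces a negative slope at [rho], and convexity
    gives the position of [f] on both sides. *)
Lemma exists_crossing : exists rho, crossing a2 f df rho.
Proof.
have [s s01 fs] := exists_below.
have f0 := profile_at0 prof.
have i12 : a2%:R^-1 < a1%:R^-1 :> R by rewrite ltf_pV2// ltr_nat.
have [|||rho] := @IVT R (f) 0 s a2%:R^-1.
- lra.
- by apply: continuous_subspaceT; exact: (profile_cont prof).
- rewrite f0 ge_min le_max; apply/andP; split; apply/orP; [right|left]; lra.
rewrite in_itv/= => /andP[rho0 rhos] frho; exists rho.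
have rho0' : 0 < rho.
  by rewrite lt_neqAle rho0 andbT; apply/eqP => E; move: frho; rewrite -E f0; lra.
have rhos' : rho < s.
  by rewrite lt_neqAle rhos andbT; apply/eqP => E; move: frho; rewrite E; lra.
have Drho : df rho < 0.
  rewrite -(@ltr_pM2r _ (s - rho)) ?subr_gt0// mul0r.
  have : df rho * (s - rho) <= f s - f rho by apply: sub; lra.
  lra.
split=> //; first lra.
- move=> r r0 rr; have : df rho * (r - rho) <= f r - f rho by apply: sub; lra.
  have : 0 < df rho * (r - rho) by rewrite nmulr_lgt0; lra.
  lra.
- move=> r rr r1; have [rs|sr|->//] := ltgtP r s; last first.
    by rewrite -f1; apply: (@profile_lt_right s); rewrite ?f1; lra.
  have h1 : df r * (rho - r) <= f rho - f r by apply: sub; lra.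
  have h2 : df r * (s - r) <= f s - f r by apply: sub; lra.
  rewrite ltNge; apply/negP => h3.
  have : 0 <= df r by rewrite -(@ler_nM2r _ (rho - r)) ?subr_lt0// mul0r; lra.
  have : df r < 0 by rewrite -(@ltr_pM2r _ (s - r)) ?subr_gt0// mul0r; lra.
  lra.
Qed.

Lemma crossing_inf rho : crossing a2 f df rho ->
  inf [set r : R | 0 <= r <= 1 /\ f r = a2%:R^-1] = rho.
Proof.
move=> [rho01 frho _ gt lt]; apply/eqP; rewrite eq_le; apply/andP; split.
- apply: ge_inf; first by exists 0 => r /= [/andP[]].
  by rewrite /=; split=> //; lra.
- apply: lb_le_inf; first by exists rho; rewrite /=; split=> //; lra.
  move=> r /= [/andP[r0 r1] fr]; rewrite leNgt; apply/negP => /(gt _ r0); lra.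
Qed.

Lemma crossing_unique rho r : crossing a2 f df rho ->
  0 <= r -> r < 1 -> f r = a2%:R^-1 -> r = rho.
Proof.
move=> [_ _ _ gt lt] rge0 r1 fr.
by have [/(gt _ rge0)|/lt/(_ r1)|//] := ltgtP r rho; rewrite fr ltxx.
Qed.

End Crossing.

Lemma r0_crossing (R : realType) (a1 a2 : nat) (t : R) :
  (0 < a1)%N -> (a1 < a2)%N -> 1 < t ->
  crossing a2 (fun r => mu a1 a2 r t) (dmu a1 a2 t) (r0 a1 a2 t).
Proof.
move=> a1_gt0 a12 t1.
have prof := mu_profile a1_gt0 (leq_trans (ltn0Sn _) a12) t1.
have [rho H] := exists_crossing a1_gt0 a12 prof.
by rewrite /r0 (crossing_inf H).
Qed.

(** * Kronecker's theorem *)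

Section Kronecker.
Variables (R : realType) (theta : R).
Hypothesis theta_irr : irrational theta.

Lemma irrational_neq0 (p : int) (q : nat) : (0 < q)%N -> p%:~R - q%:R * theta != 0.
Proof.
move=> q0; apply/eqP => E; apply: theta_irr; exists (p%:~R / q%:R) => //.
have q0' : q%:R != 0 :> R by rewrite pnatr_eq0 -lt0n.
rewrite fmorph_div rmorph_int rmorph_nat; apply: (mulfI q0').
by rewrite mulrCA mulfV// mulr1; lra.
Qed.

(** Two consecutive multiples of [d] enclose 1, and the closer one is within [d / 2]. *)
Lemma exists_near_inverse (d : R) : 0 < d <= 1 ->
  exists2 k : nat, (0 < k)%N & `|k%:R * d - 1| <= d / 2.
Proof.
move=> /andP[d0 d1]; have i0 : 0 <= d^-1 by rewrite invr_ge0 ltW.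
have /andP[k1 k2] := truncn_itv i0; set k := Num.trunc d^-1 in k1 k2.
have k0 : (0 < k)%N by rewrite truncn_gt0 invf_ge1.
have {}k1 : k%:R * d <= 1 by rewrite -ler_pdivlMr// mul1r.
have {}k2 : 1 < (k%:R + 1) * d by rewrite natr1 -ltr_pdivrMr// mul1r.
have [h|h] := leP (1 - k%:R * d) (d / 2).
  by exists k => //; rewrite ler_norml; lra.
by exists k.+1 => //; rewrite -natr1 ler_norml; lra.
Qed.

(** Induction by halving: if [d] is the absolute value of a combination, the multiple of [d] nearest
    to 1 differs from 1 by at most [d / 2], and this difference is up to sign another combination.
    Irrationality keeps it nonzero. *)
Lemma small_combination (n : nat) : exists p : int, exists2 q : nat, (0 < q)%N &
  0 < `|p%:~R - q%:R * theta| <= 2^-1 ^+ n.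
Proof.
elim: n => [|n [p [q q0 /andP[d0 dn]]]].
  exists (Num.ceil theta), 1%N => //; rewrite expr0 normr_gt0 irrational_neq0//= mul1r.
  have := ceil_ge theta; have := ceilB1_lt theta; rewrite intrB => h1 h2.
  by rewrite ler_norml; lra.
have d1 : `|p%:~R - q%:R * theta| <= 1.
  by apply: le_trans dn _; rewrite exprn_ile1//; lra.
have [k k0 Hk] := exists_near_inverse (introT andP (conj d0 d1)).
(* [s] is the sign of the old combination; subtracting it from [k * p] subtracts 1 from [k] times
   the absolute value, up to that sign. *)
have [s [s1 Es]] : exists s : int, `|s%:~R| = 1 :> R /\
    `|p%:~R - q%:R * theta| = s%:~R * (p%:~R - q%:R * theta).
  have [h|h] := leP 0 (p%:~R - q%:R * theta).
    by exists 1; rewrite normr1 mul1r ger0_norm.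
  by exists (-1); rewrite mulrN1z mulN1r normrN1 ltr0_norm.
have s2 : s%:~R * s%:~R = 1 :> R.
  by rewrite -expr2 -real_normK ?s1 ?expr1n// num_real.
exists (k%:Z * p - s), (k * q)%N; first by rewrite muln_gt0 k0.
rewrite normr_gt0 irrational_neq0 ?muln_gt0 ?k0//=.
have -> : (k%:Z * p - s)%:~R - (k * q)%:R * theta =
    s%:~R * (k%:R * `|p%:~R - q%:R * theta| - 1).
  rewrite Es intrB intrM natrM -pmulrn.
  transitivity ((s%:~R * s%:~R) * (k%:R * (p%:~R - q%:R * theta)) - s%:~R); last ring.
  by rewrite s2; ring.
rewrite normrM s1 mul1r exprS; apply: le_trans Hk _; lra.
Qed.

Lemma progression_meets (y0 a h : R) : 0 < h -> y0 <= a ->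
  exists j : nat, a < y0 + j%:R * h <= a + h.
Proof.
move=> h0 ya; have i0 : 0 <= (a - y0) / h by rewrite divr_ge0 ?subr_ge0// ltW.
have /andP[k1 k2] := truncn_itv i0; set k := Num.trunc _ in k1 k2.
exists k.+1; move: k1 k2; rewrite ler_pdivlMr// ltr_pdivrMr// -natr1; lra.
Qed.

(** A progression whose step is shorter than [b - a] cannot jump over the interval. It starts at
    [n = N], from an integer [K] that puts the first term on the proper side: above [b] for a
    negative step, below [a] for a positive one. *)
Lemma kronecker_dense (a b : R) (N : nat) : a < b ->
  exists n : nat, exists2 k : int, (N <= n)%N & a < k%:~R - n%:R * theta < b.
Proof.
move=> ab; have ba : 0 < b - a by lra.
have [n nab] : exists n, 2^-1 ^+ n < b - a :> R.
  have /cvgrPdist_lt/(_ _ ba) : (2^-1 ^+ n : R) @[n --> \oo] --> 0.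
    by apply: cvg_expr; rewrite ger0_norm; lra.
  move=> [n _ H]; exists n; have := H n (leqnn n).
  by rewrite /= sub0r normrN ger0_norm// exprn_ge0//; lra.
have [p [q q0 /andP[]]] := small_combination n.
rewrite normr_gt0 neq_lt => /orP[h|h].
- rewrite ltr0_norm// => h'.
  have h0 : 0 < - (p%:~R - q%:R * theta) by lra.
  have := ceil_ge (b + N%:R * theta); set K := Num.ceil _ => HK.
  have yb : - (K%:~R - N%:R * theta) <= - b by lra.
  have [j /andP[j1 j2]] := progression_meets h0 yb.
  exists (N + j * q)%N, (K + j%:Z * p); first exact: leq_addr.
  rewrite natrD natrM intrD intrM -pmulrn; lra.
- rewrite gtr0_norm// => h'.
  have := floor_le (a + N%:R * theta); set K := Num.floor _ => HK.
  have ya : (K%:~R - N%:R * theta) <= a by lra.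
  have [j /andP[j1 j2]] := progression_meets h ya.
  exists (N + j * q)%N, (K + j%:Z * p); first exact: leq_addr.
  rewrite natrD natrM intrD intrM -pmulrn; lra.
Qed.

End Kronecker.

(** * Avoiding finite sets; arithmetic and lengths of factorizations *)

Lemma finite_set_avoid (R : realType) (A : set R) (a b : R) : finite_set A -> a < b ->
  exists a' b', [/\ a <= a', a' < b', b' <= b & forall z, a' < z < b' -> ~ A z].
Proof.
move=> /finite_seqP[s ->] ab; elim: s => [|x s [a' [b' [aa ab' bb H]]]].
  by exists a, b.
have [xa|ax] := leP x a'; [|have [bx|xb] := leP b' x].
- exists a', b'; split=> // z z1 /=; rewrite inE => /orP[/eqP|/(H _ z1)//]; lra.
- exists a', b'; split=> // z z1 /=; rewrite inE => /orP[/eqP|/(H _ z1)//]; lra.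
exists a', x; split=> //; first lra.
move=> z z1 /=; rewrite inE => /orP[/eqP|]; first lra.
apply: H; lra.
Qed.

Lemma factorization_shift (a1 a2 m n m' n' : nat) : coprime a1 a2 -> (0 < a1)%N ->
  (m * a1 + n * a2 = m' * a1 + n' * a2)%N -> (n <= n')%N ->
  exists k, n' = (n + k * a1)%N /\ m = (m' + k * a2)%N.
Proof.
move=> co a10 E nn'.
have E' : ((n' - n) * a2 = (m - m') * a1)%N by rewrite !mulnBl; nia.
have /dvdnP[k Ek] : (a1 %| n' - n)%N.
  by rewrite -(Gauss_dvdl _ co) E' dvdn_mull.
exists k; split; first lia.
apply/eqP; rewrite -(eqn_pmul2r a10); apply/eqP; nia.
Qed.

(** At [r = n a2 / x] the entries [(1 - r) / a1] and [r / a2] are [m / x] and [n / x]; homogeneity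
    does the rest. *)
Lemma tnorm_mu (R : realType) (a1 a2 : nat) (t : R) (m n x : nat) :
  (0 < a1)%N -> (0 < a2)%N -> 0 < t -> (0 < x)%N -> (m * a1 + n * a2 = x)%N ->
  tnorm t m%:R n%:R = x%:R * mu a1 a2 (n%:R * a2%:R / x%:R) t.
Proof.
move=> a10 a20 t0 x0 E.
have X : x%:R != 0 :> R by rewrite pnatr_eq0 -lt0n.
have A1 : a1%:R != 0 :> R by rewrite pnatr_eq0 -lt0n.
have A2 : a2%:R != 0 :> R by rewrite pnatr_eq0 -lt0n.
rewrite /mu -(tnormZ _ _ t0 (ler0n _ _)); congr (tnorm t _ _).
  have -> : m%:R = (x%:R - n%:R * a2%:R) / a1%:R :> R.
    by rewrite -E natrD !natrM addrK mulfK.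
  by field; rewrite X A1.
by field; rewrite X A2.
Qed.

Lemma exists_dominating_nat (R : realType) (u v : R) : 0 < v -> exists N : nat, forall x : nat,
  (N <= x)%N -> u < x%:R * v.
Proof.
move=> v0; exists (Num.trunc (u / v)).+1 => x Nx; rewrite -ltr_pdivrMr//.
by apply: lt_le_trans (truncnS_gt _) _; rewrite ler_nat.
Qed.

(** Reducing [m] modulo [a2] moves as much as possible to the second entry and yields the
    factorization whose point is closest to 1. A larger second entry would require [m1] to be at
    least [a2]. *)
Lemma top_factorization (a1 a2 m n : nat) : coprime a1 a2 -> (0 < a1)%N -> (0 < a2)%N ->
  exists m1 n1, [/\ (m1 < a2)%N, (m1 * a1 + n1 * a2 = m * a1 + n * a2)%N &
  forall m' n', (m' * a1 + n' * a2 = m * a1 + n * a2)%N ->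
    exists k, n1 = (n' + k * a1)%N].
Proof.
move=> co a10 a20; exists (m %% a2)%N, (n + m %/ a2 * a1)%N.
have m1a2 : (m %% a2 < a2)%N by rewrite ltn_mod.
have E : (m %% a2 * a1 + (n + m %/ a2 * a1) * a2 = m * a1 + n * a2)%N.
  by rewrite {3}(divn_eq m a2) !mulnDl; lia.
split=> // m' n' E'.
have [h|h] := leqP n' (n + m %/ a2 * a1).
  have [k [Ek _]] := factorization_shift co a10 (etrans E' (esym E)) h.
  by exists k.
have [[|k] [Ek1 Ek2]] := factorization_shift co a10 (etrans E (esym E')) (ltnW h).
  by exists 0%N; rewrite Ek1; lia.
by move: m1a2; rewrite Ek2 mulSn; lia.
Qed.

Section Lengths.
Variables (R : realType) (a1 a2 : nat) (t : R) (f df : R -> R) (rho : R).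
Hypotheses (a1_gt0 : (0 < a1)%N) (a12 : (a1 < a2)%N) (co : coprime a1 a2).
Hypothesis prof : profile a1 a2 f df.
Hypothesis cross : crossing a2 f df rho.
(* The factorization (m, n) of x has length x f(r) with r = n a2 / x. *)
Hypothesis len : forall m n x : nat, (0 < x)%N -> (m * a1 + n * a2 = x)%N ->
  tnorm t m%:R n%:R = x%:R * f (n%:R * a2%:R / x%:R).

Let a2_gt0 : (0 < a2)%N. Proof. exact: leq_trans a12. Qed.
Let A1 : 0 < a1%:R :> R. Proof. by rewrite ltr0n. Qed.
Let A2 : 0 < a2%:R :> R. Proof. by rewrite ltr0n. Qed.
Let A12 : 0 < a1%:R * a2%:R :> R. Proof. by rewrite mulr_gt0. Qed.
Let sub := profile_sub prof.
Let f1 := profile_at1 prof.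

(** From [rho] on, the endpoint 1 included, the profile does not exceed [1 / a2]. *)
Lemma lt_crossing q : 0 <= q <= 1 -> a2%:R^-1 < f q -> q < rho.
Proof.
have [rho01 frho drho _ _] := cross.
move=> /andP[q0 q1] fq; rewrite ltNge; apply/negP; rewrite le_eqVlt => /predU1P[E|rq].
  by move: fq; rewrite -E frho ltxx.
move: q1; rewrite le_eqVlt => /predU1P[E|q1]; first by move: fq; rewrite E f1 ltxx.
have := crossing_lt cross rq q1; lra.
Qed.

Lemma profile_decreasing q r : 0 <= q -> q <= r -> r <= rho -> f r <= f q.
Proof.
have [rho01 frho drho _ _] := cross.
move=> q0 qr rrho; have dr : df r <= 0.
  apply: le_trans (ltW drho); apply: (profile_dhomo prof); lra.
have h : df r * (q - r) <= f q - f r by apply: sub; lra.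
have : 0 <= df r * (q - r) by rewrite mulr_le0//; lra.
lra.
Qed.

Lemma ratio_itv (m n x : nat) : (0 < x)%N -> (m * a1 + n * a2 = x)%N ->
  0 <= (n%:R * a2%:R / x%:R : R) <= 1.
Proof.
move=> x0 E; have X : 0 < x%:R :> R by rewrite ltr0n.
rewrite divr_ge0 ?mulr_ge0//= ler_pdivrMr// mul1r -natrM ler_nat; lia.
Qed.

(** * Gaps when the crossing point is irrational *)

(** Lengths above [l] come from points left of [rho], where they decrease as the second entry grows
    by multiples of [a1]. So only [n + a1] and its successors could fall inside the gap, and the
    last hypothesis keeps them out. *)
Lemma Delta_left_gap (m n x : nat) (l : R) : (0 < x)%N -> (m * a1 + n * a2 = x)%N ->
  Lset a1 a2 t x l -> x%:R / a2%:R <= l -> l < x%:R * f (n%:R * a2%:R / x%:R) ->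
  ((n + a1)%:R * a2%:R / x%:R < rho -> x%:R * f ((n + a1)%:R * a2%:R / x%:R) <= l) ->
  Delta_S a1 a2 t (x%:R * f (n%:R * a2%:R / x%:R) - l).
Proof.
have [rho01 frho drho _ _] := cross.
move=> x0 E Ll xl lL gap; have X : 0 < x%:R :> R by rewrite ltr0n.
exists x; first by exists m, n.
exists l, (x%:R * f (n%:R * a2%:R / x%:R)); split=> //.
  by exists (m, n) => //=; rewrite (len x0 E).
move=> _ [[m' n'] E' <-]; have {}E' : (m' * a1 + n' * a2)%N = x by [].
rewrite /= (len x0 E') => /andP[h1 h2].
move: h2; rewrite ltr_pM2l// => h2.
have q01 := ratio_itv x0 E'; have r01 := ratio_itv x0 E.
have qrho : n'%:R * a2%:R / x%:R < rho.
  by apply: lt_crossing => //; rewrite -(@ltr_pM2l _ x%:R)//; apply: le_lt_trans h1.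
have nn' : (n < n')%N.
  rewrite ltnNge; apply/negP => nn'; move: h2; rewrite ltNge => /negP; apply.
  apply: profile_decreasing; first by case/andP: q01.
    by rewrite ler_pM2r ?invr_gt0// ler_pM2r// ler_nat.
  apply: ltW; apply: lt_crossing => //.
  by rewrite -(@ltr_pM2l _ x%:R)//; apply: le_lt_trans lL.
have [k [Ek _]] := factorization_shift co a1_gt0 (etrans E (esym E')) (ltnW nn').
have nn1 : (n + a1 <= n')%N.
  rewrite Ek leq_add2l leq_pmull//.
  by case: k Ek nn' => //; rewrite mul0n addn0 => ->; rewrite ltnn.
have le1 : (n + a1)%:R * a2%:R / x%:R <= n'%:R * a2%:R / x%:R :> R.
  by rewrite ler_pM2r ?invr_gt0// ler_pM2r// ler_nat.
have := gap (le_lt_trans le1 qrho); apply/negP; rewrite -ltNge.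
apply: lt_le_trans h1 _; rewrite ler_pM2l//.
by apply: profile_decreasing => //; exact: ltW.
Qed.

(** Such a [y] is [- a1 a2] times the slope at some [s] left of [rho]. The gap between the lengths
    of two neighbouring points around [s] lies between [- a1 a2] times their slopes. *)
Lemma Delta_near_left_slope (y e : R) : - df rho * (a1%:R * a2%:R) < y -> y < a2%:R ->
  0 < e -> exists2 d, Delta_S a1 a2 t d & `|d - y| < e.
Proof.
have [rho01 frho drho _ _] := cross.
move=> cy ya2 e0.
have [s /andP[s0 srho] dfs] : exists2 s, 0 <= s < rho & df s = - y / (a1%:R * a2%:R).
  have y1 : - y / (a1%:R * a2%:R) < df rho by rewrite ltr_pdivrMr//; lra.
  have y2 : - a1%:R^-1 < - y / (a1%:R * a2%:R).
    by rewrite ltr_pdivlMr// mulNr mulrA mulVf ?gt_eqF// mul1r ltrN2.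
  have [|||s] := @IVT R df 0 rho (- y / (a1%:R * a2%:R)).
  - lra.
  - by apply: continuous_subspaceT; exact: (profile_dcont prof).
  - rewrite (profile_dat0 prof) ge_min le_max; apply/andP; split; apply/orP; [left|right]; lra.
  rewrite in_itv/= => /andP[s0 srho] dfs; exists s => //; rewrite s0 lt_neqAle srho andbT.
  by apply/eqP => Es; move: y1; rewrite -dfs Es ltxx.
have eA : 0 < e / (a1%:R * a2%:R) by rewrite divr_gt0.
have [d0 d00 Hd] := @continuous_eps_delta _ _ s _ (profile_dcont prof) eA.
(* The bound [rho - s] keeps the right neighbour [r'] of [s] left of [rho]. *)
pose d1 := Num.min d0 (rho - s).
have d10 : 0 < d1 by rewrite lt_min d00 subr_gt0.
pose M := (Num.trunc d1^-1).+1.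
have M0 : 0 < M%:R :> R by rewrite ltr0n.
have Md : M%:R^-1 < d1.
  rewrite -[ltRHS]invrK ltf_pV2 ?posrE ?invr_gt0//.
  exact: truncnS_gt.
have [Md0 Mrho] : M%:R^-1 < d0 /\ M%:R^-1 < rho - s.
  by move: Md; rewrite lt_min => /andP.
have sM : 0 <= s * M%:R by rewrite mulr_ge0// ltW.
have /andP[j1 j2] := truncn_itv sM; set j := Num.trunc _ in j1 j2.
have {}j1 : j%:R / M%:R <= s by rewrite ler_pdivrMr.
have {}j2 : s < j.+1%:R / M%:R by rewrite ltr_pdivlMr.
have jS : j.+1%:R / M%:R = j%:R / M%:R + M%:R^-1 :> R by rewrite -natr1 mulrDl mul1r.
have jM : (j.+1 <= M)%N.
  by rewrite -(ler_nat R) -[leRHS]mul1r -ler_pdivrMr//; lra.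
have j0 : 0 <= j%:R / M%:R :> R by rewrite divr_ge0.
set r := j%:R / M%:R in j0 j1 jS; set r' := j.+1%:R / M%:R in j2 jS.
(* The points of this [x] include every [j / M], so [r] and [r'] are two consecutive ones. *)
pose x := (M * (a1 * a2))%N.
have x0 : (0 < x)%N by rewrite !muln_gt0 a1_gt0 a2_gt0.
have X : x%:R = M%:R * (a1%:R * a2%:R) :> R by rewrite !natrM.
have X0 : 0 < x%:R :> R by rewrite ltr0n.
have Ek k : (k <= M)%N -> ((M - k) * a2 * a1 + k * a1 * a2 = x)%N.
  by move=> kM; rewrite -!mulnA [(a2 * a1)%N]mulnC -mulnDl subnK.
have E := Ek _ (ltnW jM); have E' := Ek _ jM.
have Er : (j * a1)%:R * a2%:R / x%:R = r.
  by rewrite X natrM /r; field; rewrite !gt_eqF.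
have Er' : (j * a1 + a1)%:R * a2%:R / x%:R = r'.
  by rewrite addnC -mulSn X natrM /r'; field; rewrite !gt_eqF.
have h1 : df r' * (r - r') <= f r - f r' by apply: sub; lra.
have h2 : df r * (r' - r) <= f r' - f r by apply: sub; lra.
have dr' : df r' < 0.
  apply: le_lt_trans drho; apply: (profile_dhomo prof); lra.
have ff : f r' < f r.
  have : 0 < df r' * (r - r') by rewrite nmulr_rgt0//; lra.
  lra.
exists (x%:R * f r - x%:R * f r').
  rewrite -{1}Er; apply: (Delta_left_gap x0 E).
  - exists ((M - j.+1) * a2, j.+1 * a1)%N => //=.
    by rewrite (len x0 E') -Er' mulSnr.
  - rewrite ler_pM2l//; apply: ltW; apply: (crossing_gt cross); lra.
  - by rewrite Er ltr_pM2l.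
  - by rewrite Er'.
have r1 : `|r - s| < d0 by rewrite ltr_norml; lra.
have r'1 : `|r' - s| < d0 by rewrite ltr_norml; lra.
have := Hd _ r1; have := Hd _ r'1; rewrite dfs !ltr_pdivlMr//.
have -> : `|df r - - y / (a1%:R * a2%:R)| * (a1%:R * a2%:R) =
    `|df r * (a1%:R * a2%:R) + y|.
  by rewrite -[X in _ * X](gtr0_norm A12) -normrM; congr `|_|; field; rewrite !gt_eqF.
have -> : `|df r' - - y / (a1%:R * a2%:R)| * (a1%:R * a2%:R) =
    `|df r' * (a1%:R * a2%:R) + y|.
  by rewrite -[X in _ * X](gtr0_norm A12) -normrM; congr `|_|; field; rewrite !gt_eqF.
rewrite !ltr_norml -mulrBr.
have h1' : - (df r' * (a1%:R * a2%:R)) <= x%:R * (f r - f r').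
  move: h1; rewrite -(ler_pM2l X0); apply: le_trans.
  by rewrite jS X le_eqVlt; apply/orP; left; apply/eqP; field; rewrite !gt_eqF.
have h2' : x%:R * (f r - f r') <= - (df r * (a1%:R * a2%:R)).
  have -> : x%:R * (f r - f r') = - (x%:R * (f r' - f r)) by ring.
  rewrite lerN2; have {}h2 : x%:R * (df r * (r' - r)) <= x%:R * (f r' - f r).
    by rewrite ler_pM2l.
  apply: le_trans h2.
  by rewrite jS X le_eqVlt; apply/orP; left; apply/eqP; field; rewrite !gt_eqF.
lra.
Qed.

(** For [x = n1 a2] the factorization [(0, n1)] has length [x / a2]. The gap above it is close to
    [- df rho] times [x (rho - r)], where [r] is the last point left of [rho], and Kronecker's
    theorem prescribes this offset. *)
Lemma Delta_near_phase (y e : R) : irrational rho ->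
  0 < y -> y < - df rho * (a1%:R * a2%:R) -> 0 < e ->
  exists2 d, Delta_S a1 a2 t d & `|d - y| < e.
Proof.
have [rho01 frho drho _ _] := cross.
move=> irr y0 yc e0; pose A : R := a1%:R * a2%:R.
have A0 : 0 < A by exact: A12.
pose g := - df rho; have g0 : 0 < g by rewrite oppr_gt0.
pose w := y / g; have w0 : 0 < w by rewrite divr_gt0.
have wA : w < A by rewrite ltr_pdivrMr// mulrC.
have gw : g * w = y by rewrite /w mulrC divfK// gt_eqF.
(* [w] is the offset for which the linearized gap is [y]. The first bound keeps the offset below
   [A], the spacing of the points scaled by [x]; the second keeps the linearized gap within [e / 2]
   of [y]. *)
pose e2 := Num.min (A - w) (e / (2 * g)).
have e20 : 0 < e2 by rewrite lt_min subr_gt0 wA divr_gt0// mulr_gt0.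
have [e2A e2e] : e2 <= A - w /\ g * e2 <= e / 2.
  split; first by rewrite ge_min lexx.
  have : e2 <= e / (2 * g) by rewrite ge_min lexx orbT.
  rewrite -(ler_pM2l g0) => /le_trans; apply.
  by rewrite le_eqVlt; apply/orP; left; apply/eqP; field; rewrite gt_eqF.
have eA : 0 < e / (2 * A) by rewrite divr_gt0// mulr_gt0.
have [d0 d00 Hd] := @continuous_eps_delta _ _ rho _ (profile_dcont prof) eA.
have a1R : a1%:R != 0 :> R by rewrite gt_eqF.
have th_irr : irrational ((1 - rho) / a1%:R).
  move=> [q _ Eq]; apply: irr; exists (1 - a1%:R * q) => //.
  have -> : ratr (1 - a1%:R * q) = 1 - a1%:R * ratr q :> R.
    by rewrite rmorphB rmorph1 rmorphM rmorph_nat.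
  by rewrite Eq; field.
have ab : w / A < (w + e2) / A by rewrite ltr_pM2r ?invr_gt0//; lra.
have rho0 : 0 < rho by lra.
(* The two summands ensure that [k * a1] is at most [n1] and that [r] is within [d0] of [rho]. *)
pose N := (Num.trunc (a1%:R / rho + a1%:R / d0)).+1.
have [n1 [k' Nn]] := kronecker_dense th_irr N ab.
have n1N : a1%:R / rho + a1%:R / d0 < n1%:R.
  by apply: lt_le_trans (truncnS_gt _) _; rewrite ler_nat.
have [p1 p2] : 0 < a1%:R / rho /\ 0 < a1%:R / d0 by rewrite !divr_gt0.
have n1rho : a1%:R < n1%:R * rho by rewrite -ltr_pdivrMr//; lra.
have n1d : a1%:R < n1%:R * d0 by rewrite -ltr_pdivrMr//; lra.
have n10 : 0 < n1%:R :> R by lra.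
rewrite ltr_pdivrMr// ltr_pdivlMr// => /andP[s1 s2].
have thpos : 0 < n1%:R * ((1 - rho) / a1%:R).
  by rewrite mulr_gt0// divr_gt0//; lra.
have k'0 : 0 < k'%:~R :> R.
  have : 0 < k'%:~R - n1%:R * ((1 - rho) / a1%:R).
    by rewrite -(@ltr_pM2r _ A)// mul0r; lra.
  lra.
have [k Ek] : exists k : nat, k' = k.
  by move: k'0; rewrite ltr0z; case: k' {s1 s2} => // k _; exists k.
rewrite Ek -pmulrn in s1 s2.
set sg := (_ * A) in s1 s2.
have sgE : sg = n1%:R * a2%:R * rho - (n1%:R - k%:R * a1%:R) * a2%:R.
  by rewrite /sg /A; field.
have kn : (k * a1 <= n1)%N.
  rewrite -(ler_nat R) natrM -subr_ge0 -(@ler_pM2r _ a2%:R)// mul0r.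
  have : a1%:R * a2%:R < n1%:R * rho * a2%:R by rewrite ltr_pM2r.
  rewrite -/A; lra.
pose x := (n1 * a2)%N.
have x0 : (0 < x)%N by rewrite muln_gt0 a2_gt0 -(ltr0n R) n10.
have X0 : 0 < x%:R :> R by rewrite ltr0n.
have X : x%:R = n1%:R * a2%:R :> R by rewrite natrM.
have E : (k * a2 * a1 + (n1 - k * a1) * a2 = x)%N.
  by rewrite -mulnA [(a2 * a1)%N]mulnC mulnA -mulnDl subnKC.
have E1 : (0 * a1 + n1 * a2 = x)%N by [].
set n := (n1 - k * a1)%N in E.
have nR : n%:R = n1%:R - k%:R * a1%:R :> R by rewrite natrB// natrM.
pose r : R := n%:R * a2%:R / x%:R.
have r01 := ratio_itv x0 E; rewrite -/r in r01.
have rE : x%:R * (rho - r) = sg.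
  by rewrite sgE -nR X /r X; field; rewrite !gt_eqF.
have rrho : r < rho.
  by rewrite -subr_gt0 -(@ltr_pM2l _ x%:R)// mulr0 rE; lra.
have rd : `|r - rho| < d0.
  rewrite ltr0_norm ?subr_lt0// opprB -(@ltr_pM2l _ x%:R)// rE X.
  have : A < n1%:R * a2%:R * d0.
    by rewrite /A mulrAC ltr_pM2r.
  lra.
have fr : a2%:R^-1 < f r by apply: (crossing_gt cross) => //; case/andP: r01.
have xa2 : x%:R * f 1 = x%:R / a2%:R by rewrite f1.
exists (x%:R * f r - x%:R / a2%:R).
  apply: (Delta_left_gap x0 E).
  - exists (0%N, n1) => //=; rewrite (len x0 E1) -xa2; congr (_ * f _).
    by rewrite X divff// mulf_neq0// gt_eqF.
  - by [].
  - by rewrite ltr_pM2l.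
  (* The offset is less than [A], so the next point is already past [rho] and the condition is
     vacuous. *)
  - have -> : (n + a1)%:R * a2%:R / x%:R = r + A / x%:R :> R.
      by rewrite natrD !mulrDl.
    move=> h; exfalso; have : x%:R * (r + A / x%:R) < x%:R * rho by rewrite ltr_pM2l.
    rewrite mulrDr [_ * (A / _)]mulrC divfK ?gt_eqF//; lra.
have h1 : df rho * (r - rho) <= f r - f rho by apply: sub; lra.
have h2 : df r * (rho - r) <= f rho - f r by apply: sub; lra.
have {}h1 : g * sg <= x%:R * f r - x%:R / a2%:R.
  have := h1; rewrite -(ler_pM2l X0) => h; rewrite -frho -mulrBr; apply: le_trans h.
  by rewrite -rE /g; lra.
have {}h2 : x%:R * f r - x%:R / a2%:R <= - df r * sg.
  have := h2; rewrite -(ler_pM2l X0) => h; rewrite -frho.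
  by move: h; rewrite -rE; lra.
have sg0 : 0 < sg by lra.
have := Hd _ rd; rewrite ltr_norml => /andP[h3 _].
have h4 : - df r * sg <= (g + e / (2 * A)) * sg by rewrite ler_pM2r// /g; lra.
have h5 : e / (2 * A) * sg < e / 2.
  have -> : e / 2 = e / (2 * A) * A by field; rewrite gt_eqF.
  by rewrite ltr_pM2l//; lra.
have h6 : g * w < g * sg by rewrite ltr_pM2l.
have h7 : g * sg < g * (w + e2) by rewrite ltr_pM2l.
rewrite ltr_norml; lra.
Qed.

Lemma irrational_crossing_dense : irrational rho ->
  [set y : R | 0 <= y <= a2%:R] `<=` closure (Delta_S a1 a2 t).
Proof.
move=> irr y /= /andP[y0 ya] B /nbhs_normP[e /= e0 He].
pose c := - df rho * (a1%:R * a2%:R).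
(* The target is moved slightly, to a [z] strictly between 0 and [a2] and different from [c], so
   that one of the two preceding lemmas applies. *)
have ab : Num.max 0 (y - e / 2) < Num.min a2%:R (y + e / 2).
  by rewrite gt_max !lt_min; have := A2; lra.
have [a [b [aa ab' bb H]]] := finite_set_avoid (finite_set1 c) ab.
pose z := (a + b) / 2; have zab : a < z < b by rewrite /z; lra.
move: aa bb; rewrite ge_max le_min => /andP[a0 ay] /andP[b2 by_].
have zc : z != c by apply/eqP; exact: H zab.
have e2 : 0 < e / 2 by lra.
have [d dD dz] : exists2 d, Delta_S a1 a2 t d & `|d - z| < e / 2.
  move: zc; rewrite neq_lt => /orP[zc|cz].
  - by apply: Delta_near_phase => //; lra.
  - by apply: Delta_near_left_slope => //; lra.
exists d; split=> //; apply: He; rewrite /=.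
by move: dz; rewrite !ltr_norml; lra.
Qed.

(** * Gaps when the crossing point is rational *)

Local Notation ratio n x := (n%:R * a2%:R / x%:R).

(** Slopes are at most the slope [1 / a2] at 1, and the step has length [a1 a2 / x]. *)
Lemma right_step_le (m n x : nat) : (0 < x)%N -> (m * a1 + (n + a1) * a2 = x)%N ->
  x%:R * f (ratio (n + a1) x) - x%:R * f (ratio n x) <= a1%:R.
Proof.
move=> x0 E; have X : 0 < x%:R :> R by rewrite ltr0n.
have /andP[r0 r1] : 0 <= (ratio (n + a1) x : R) <= 1 by exact: ratio_itv x0 E.
have E' : ((m + a2) * a1 + n * a2 = x)%N by lia.
have r'01 : 0 <= (ratio n x : R) <= 1 by exact: ratio_itv x0 E'.
have rr : x%:R * (ratio (n + a1) x - ratio n x) = a1%:R * a2%:R :> R.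
  by rewrite natrD; field; rewrite gt_eqF.
have := profile_dhomo prof r0 r1 (lexx 1); rewrite (profile_dat1 prof).
move: rr r0 r1 r'01; set r := ratio (n + a1) x; set r' := ratio n x.
move=> rr r0 r1 r'01 d1.
have h : df r * (r' - r) <= f r' - f r by apply: sub; lra.
have h1 : x%:R * (df r * (r' - r)) <= x%:R * (f r' - f r) by rewrite ler_pM2l.
have h2 : df r * (a1%:R * a2%:R) <= a2%:R^-1 * (a1%:R * a2%:R) by rewrite ler_pM2r.
have h3 : a2%:R^-1 * (a1%:R * a2%:R) = a1%:R :> R by field; rewrite gt_eqF.
have h4 : x%:R * (df r * (r' - r)) = - (df r * (a1%:R * a2%:R)) by rewrite -rr; ring.
lra.
Qed.

(** Among [n], [n + a1], and so on up to [n + k a1], some step leads from a length at most that of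
    [n] to a greater one. The latter is at least [l2], and a step raises the length by at most
    [a1]. *)
Lemma low_gap_le (x n : nat) (l2 : R) : (0 < x)%N ->
  (forall l, Lset a1 a2 t x l -> ~ (x%:R * f (ratio n x) < l < l2)) ->
  forall k m, (m * a1 + (n + k * a1) * a2 = x)%N ->
  x%:R * f (ratio n x) < x%:R * f (ratio (n + k * a1) x) ->
  l2 - x%:R * f (ratio n x) <= a1%:R.
Proof.
move=> x0 gap; elim => [|k IH] m E; first by rewrite mul0n addn0 ltxx.
move=> h; have E' : ((m + a2) * a1 + (n + k * a1) * a2 = x)%N by lia.
have [h'|h'] := leP (x%:R * f (ratio (n + k * a1) x)) (x%:R * f (ratio n x)); last exact: IH E' h'.
have Ek : (n + k.+1 * a1 = n + k * a1 + a1)%N by lia.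
have : l2 <= x%:R * f (ratio (n + k.+1 * a1) x).
  rewrite leNgt; apply/negP => h2; apply: (gap (x%:R * f (ratio (n + k.+1 * a1) x))).
    by exists (m, (n + k.+1 * a1)%N) => //=; rewrite (len x0 E).
  by rewrite h.
rewrite Ek in E *; have := right_step_le x0 E; lra.
Qed.

(** By convexity the point of [n] is at most [s], and the greater length comes from a point further
    left, at distance at least [a1 a2 / x]. Slopes there are at most [df s]. *)
Lemma left_gap_ge (s : R) (m n m' n' m1 n1 x : nat) : (0 < x)%N ->
  rho < s < 1 -> df s <= 0 ->
  (m * a1 + n * a2 = x)%N -> (m' * a1 + n' * a2 = x)%N ->
  (m1 * a1 + n1 * a2 = x)%N -> (n < n1)%N -> (n' <= n1)%N ->
  f s < f (ratio n1 x) -> f (ratio n1 x) <= f (ratio n x) ->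
  f (ratio n x) < f (ratio n' x) ->
  - df s * (a1%:R * a2%:R) <= x%:R * f (ratio n' x) - x%:R * f (ratio n x).
Proof.
move=> x0 rs ds0 E E' E1 nn1 n'n1; have X : 0 < x%:R :> R by rewrite ltr0n.
have rho01 := crossing_itv cross.
have r01 : 0 <= (ratio n x : R) <= 1 by exact: ratio_itv x0 E.
have r'01 : 0 <= (ratio n' x : R) <= 1 by exact: ratio_itv x0 E'.
have r101 : 0 <= (ratio n1 x : R) <= 1 by exact: ratio_itv x0 E1.
have ratio_lt k j : (k < j)%N -> ratio k x < ratio j x :> R.
  by move=> kj; rewrite ltr_pM2r ?invr_gt0// ltr_pM2r// ltr_nat.
have := ratio_lt _ _ nn1.
have n'r1 : (ratio n' x : R) <= ratio n1 x.
  by rewrite ler_pM2r ?invr_gt0// ler_pM2r// ler_nat.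
move=> rr1 fs1 f1n fnn'.
(* If [n'] lay between [n] and [n1], the rise from [n] would make the slope at [n'] nonnegative,
   against the later fall to [n1]. *)
have n'n : (n' < n)%N.
  rewrite ltnNge; apply/negP; rewrite leq_eqVlt => /predU1P[En|/ratio_lt nn'].
    by move: fnn'; rewrite En ltxx.
  move: (ratio n' x) (ratio n x) (ratio n1 x) r01 r'01 r101 rr1 n'r1 nn' f1n fnn'.
  move=> r' r r1 r01 r'01 r101 rr1 n'r1 nn' f1n fnn'.
  have h1 : df r' * (r - r') <= f r - f r' by apply: sub; lra.
  have h2 : df r' * (r1 - r') <= f r1 - f r' by apply: sub; lra.
  have h3 : 0 < df r' by rewrite -(@ltr_nM2r _ (r - r')) ?mul0r; lra.
  have : 0 <= df r' * (r1 - r') by rewrite mulr_ge0; lra.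
  lra.
have rs' : ratio n x <= s.
  rewrite leNgt; apply/negP => h.
  have := @profile_lt_right _ _ _ _ _ prof s (ratio n x) (ratio n1 x).
  lra.
have [k [Ek _]] := factorization_shift co a1_gt0 (etrans E' (esym E)) (ltnW n'n).
have k0 : (0 < k)%N by case: k Ek n'n => // ->; rewrite mul0n addn0 ltnn.
have rr : a1%:R * a2%:R <= x%:R * (ratio n x - ratio n' x) :> R.
  have -> : x%:R * (ratio n x - ratio n' x) = (n%:R - n'%:R) * a2%:R :> R.
    by field; rewrite gt_eqF.
  rewrite ler_pM2r// Ek natrD addrC addKr ler_nat leq_pmull//.
have dn : df (ratio n x) <= df s by apply: (profile_dhomo prof) => //; lra.
have h : df (ratio n x) * (ratio n' x - ratio n x) <= f (ratio n' x) - f (ratio n x).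
  exact: sub.
have {}h := ler_wpM2l (ltW X) h.
have h2 : - df s * (a1%:R * a2%:R) <= - df (ratio n x) * (a1%:R * a2%:R).
  by rewrite ler_pM2r// lerN2.
have h3 : - df (ratio n x) * (a1%:R * a2%:R) <=
    - df (ratio n x) * (x%:R * (ratio n x - ratio n' x)).
  by rewrite ler_wpM2l// oppr_ge0; lra.
lra.
Qed.

(** The profile is nearly linear with slope [1 / a2] close to 1, and [x (1 - r)] equals [m1 a1] at
    the top point. *)
Lemma top_length_bounds (m1 n1 x : nat) (e d : R) : (0 < x)%N -> (m1 < a2)%N ->
  (m1 * a1 + n1 * a2 = x)%N -> 0 < e ->
  (forall r, `|r - 1| < d -> `|df r - df 1| < e) -> a1%:R * a2%:R < x%:R * d ->
  `|x%:R * f (ratio n1 x) - (x%:R / a2%:R - m1%:R * a1%:R / a2%:R)| <= e * (a1%:R * a2%:R).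
Proof.
move=> x0 m1a2 E e0 Hd xd; have X : 0 < x%:R :> R by rewrite ltr0n.
have r01 : 0 <= (ratio n1 x : R) <= 1 by exact: ratio_itv x0 E.
have rE : x%:R * (1 - ratio n1 x) = m1%:R * a1%:R :> R.
  have -> : x%:R * (1 - ratio n1 x) = x%:R - n1%:R * a2%:R :> R by field; rewrite gt_eqF.
  by rewrite -E natrD !natrM addrK.
have m1A : m1%:R * a1%:R <= a1%:R * a2%:R :> R by rewrite mulrC ler_pM2l// ler_nat ltnW.
move: (ratio n1 x) r01 rE => r r01 rE.
have rd : `|r - 1| < d.
  rewrite distrC ger0_norm ?subr_ge0; last by case/andP: r01.
  by rewrite -(@ltr_pM2l _ x%:R)// rE; apply: le_lt_trans xd.
have h1 : df 1 * (r - 1) <= f r - f 1 by apply: sub; lra.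
have h2 : df r * (1 - r) <= f 1 - f r by apply: sub; lra.
have {}h1 := ler_wpM2l (ltW X) h1; have {}h2 := ler_wpM2l (ltW X) h2.
have := Hd _ rd; rewrite (profile_dat1 prof) in h1 *; rewrite f1 in h1 h2.
rewrite ltr_norml => /andP[h3 _].
have m0 : 0 <= m1%:R * a1%:R :> R by rewrite mulr_ge0.
have h4 : - e * (m1%:R * a1%:R) <= (df r - a2%:R^-1) * (m1%:R * a1%:R).
  by rewrite ler_wpM2r// ltW.
have h5 : e * (m1%:R * a1%:R) <= e * (a1%:R * a2%:R) by rewrite ler_pM2l.
rewrite -rE in h4 h5 *.
rewrite ler_norml; lra.
Qed.

(** The tangent at [rho] bounds the offset [x (r - rho)] from below, and slopes at most [df s]
    between [rho] and [s] bound it from above. A bounded offset puts [r] close to [rho], where the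
    profile is nearly linear. *)
Lemma crossing_length_bounds (s r x e d : R) : 0 < x -> rho < s < 1 ->
  df s * (a1%:R * a2%:R) <= - a1%:R -> 0 <= r -> r <= s -> 0 < e ->
  (forall r, `|r - rho| < d -> `|df r - df rho| < e) -> a1%:R * a2%:R < x * d ->
  - a1%:R <= x * f r - x / a2%:R <= - df rho * (a1%:R * a2%:R) ->
  `|x * (r - rho)| <= a1%:R * a2%:R /\
  `|x * f r - x / a2%:R - df rho * (x * (r - rho))| <= e * (a1%:R * a2%:R).
Proof.
have [rho01 frho drho _ _] := cross.
move=> x0 rs ds r0 rs' e0 Hd xd /andP[l1 l2].
have h1 : df rho * (r - rho) <= f r - f rho by apply: sub; lra.
have h2 : df r * (rho - r) <= f rho - f r by apply: sub; lra.
have {}h1 := ler_wpM2l (ltW x0) h1; have {}h2 := ler_wpM2l (ltW x0) h2.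
rewrite frho in h1 h2.
have bound : `|x * (r - rho)| <= a1%:R * a2%:R.
  rewrite ler_norml; apply/andP; split.
  - rewrite -(@ler_nM2l _ (df rho))//; lra.
  - have ds0 : df s < 0.
      by rewrite -(@ltr_pM2r _ (a1%:R * a2%:R))// mul0r; have := A1; lra.
    have [rr|rr] := leP r rho.
      have : x * (r - rho) <= 0 by rewrite mulr_ge0_le0; lra.
      have := A12; lra.
    have dr : df r <= df s by apply: (profile_dhomo prof); lra.
    have sg : 0 < x * (r - rho) by rewrite mulr_gt0; lra.
    have h3 : df r * (x * (r - rho)) <= df s * (x * (r - rho)) by rewrite ler_pM2r.
    rewrite -(@ler_nM2l _ (df s))//; lra.
split=> //.
have rd : `|r - rho| < d.
  rewrite -(@ltr_pM2l _ x)//; apply: le_lt_trans xd.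
  by rewrite -[X in X * _](gtr0_norm x0) -normrM.
have := Hd _ rd => /ltW h3.
have h4 : `|(df r - df rho) * (x * (r - rho))| <= e * (a1%:R * a2%:R).
  by rewrite normrM ler_pM.
have h5 : 0 <= x * f r - x / a2%:R - df rho * (x * (r - rho)) by lra.
rewrite ger0_norm//; apply: le_trans (le_trans (ler_norm _) h4); lra.
Qed.

(* Limits of the gaps that start at the largest length of the right branch, for the
   factorization with first entry m: Q is a denominator of rho, and k / Q - a1 a2, which ranges
   over [- a1 a2, a1 a2], is the value of x (r - rho) at the other end r. *)
Definition limit_gap (Q k m : nat) : R :=
  df rho * ((k%:R - (Q * (a1 * a2))%:R) / Q%:R) + m%:R * a1%:R / a2%:R.

(** The gap must start at the top factorization [n1]: a lower start is excluded by [low_gap_le], any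
    other by [left_gap_ge]. Its other end lies near [rho], at an offset that is an integer divided
    by [Q], so both ends are known up to [e a1 a2]. *)
Lemma gap_classification (s e d g : R) (P Q x : nat) : (0 < x)%N -> (0 < Q)%N ->
  rho * Q%:R = P%:R -> rho < s < 1 -> df s * (a1%:R * a2%:R) <= - a1%:R -> 0 < e ->
  (forall r, `|r - rho| < d -> `|df r - df rho| < e) ->
  (forall r, `|r - 1| < d -> `|df r - df 1| < e) ->
  a1%:R * a2%:R < x%:R * d -> a1%:R * a2%:R < x%:R * (1 - rho) ->
  a1%:R < x%:R * (a2%:R^-1 - f s) ->
  Delta_x a1 a2 t x g -> a1%:R < g -> g < - df s * (a1%:R * a2%:R) ->
  exists k m, [/\ (k <= 2 * (Q * (a1 * a2)))%N, (m < a2)%N &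
    `|g - limit_gap Q k m| <= 2 * e * (a1%:R * a2%:R)].
Proof.
move=> x0 Q0 rhoQ rs ds e0 Hrho H1 xd xrho xfs.
move=> [_ [_ [[[m n] E <-] [[m' n'] E' <-]]]].
have {}E : (m * a1 + n * a2 = x)%N by []; have {}E' : (m' * a1 + n' * a2 = x)%N by [].
rewrite /= (len x0 E) (len x0 E') => l12 -> gap ga1 gs.
have [rho01 frho drho _ below] := cross.
have X : 0 < x%:R :> R by rewrite ltr0n.
have [m1 [n1 [m1a2 E1 top]]] := top_factorization m n co a1_gt0 a2_gt0.
rewrite E in E1 top; have [k Ek] := top _ _ E; have [k' Ek'] := top _ _ E'.
have nn1 : (n <= n1)%N by rewrite Ek leq_addr.
have n'n1 : (n' <= n1)%N by rewrite Ek' leq_addr.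
have r01 : 0 <= (ratio n x : R) <= 1 by exact: ratio_itv x0 E.
have r'01 : 0 <= (ratio n' x : R) <= 1 by exact: ratio_itv x0 E'.
have r101 : 0 <= (ratio n1 x : R) <= 1 by exact: ratio_itv x0 E1.
have ltop : x%:R * f (ratio n1 x) <= x%:R * f (ratio n x).
  rewrite leNgt; apply/negP => h; rewrite Ek in h E1.
  have := low_gap_le x0 gap E1 h; lra.
have r1E : x%:R * (1 - ratio n1 x) = m1%:R * a1%:R :> R.
  have -> : x%:R * (1 - ratio n1 x) = x%:R - n1%:R * a2%:R :> R by field; rewrite gt_eqF.
  by rewrite -E1 natrD !natrM addrK.
have m1A : m1%:R * a1%:R <= a1%:R * a2%:R :> R by rewrite mulrC ler_pM2l// ler_nat ltnW.
have low1 : x%:R / a2%:R - a1%:R <= x%:R * f (ratio n1 x).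
  have h1 : df 1 * (ratio n1 x - 1) <= f (ratio n1 x) - f 1 by apply: sub; lra.
  have {}h1 := ler_wpM2l (ltW X) h1; rewrite (profile_dat1 prof) f1 in h1.
  have : a2%:R^-1 * (m1%:R * a1%:R) <= a2%:R^-1 * (a1%:R * a2%:R) :> R.
    by rewrite ler_pM2l ?invr_gt0.
  have -> : a2%:R^-1 * (a1%:R * a2%:R) = a1%:R :> R by field; rewrite gt_eqF.
  rewrite -r1E; lra.
have fsr1 : f s < f (ratio n1 x) by rewrite -(@ltr_pM2l _ x%:R)//; lra.
have up1 : x%:R * f (ratio n1 x) <= x%:R / a2%:R.
  rewrite ler_pM2l//; have rr1 : rho < ratio n1 x.
    have : x%:R * (1 - ratio n1 x) < x%:R * (1 - rho) by rewrite r1E; exact: le_lt_trans xrho.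
    rewrite ltr_pM2l//; lra.
  case/andP: r101 => _; rewrite le_eqVlt => /predU1P[->|h]; first by rewrite f1.
  by apply: ltW; exact: below.
have A12' := A12; have A1' := A1.
have ds0 : df s <= 0 by rewrite -(@ler_pM2r _ (a1%:R * a2%:R))// mul0r; lra.
have En : n = n1.
  apply/eqP; move: nn1; rewrite leq_eqVlt => /predU1P[->//|nn1].
  have := left_gap_ge x0 rs ds0 E E' E1 nn1 n'n1 fsr1.
  move: (ltop) (l12); rewrite ler_pM2l// ltr_pM2l// => le1n ltn' /(_ le1n ltn'); lra.
rewrite {}En in E r01 l12 gap ga1 gs nn1 {ltop} *.
have n'lt : (n' < n1)%N.
  by move: n'n1; rewrite leq_eqVlt => /predU1P[En|//]; move: l12; rewrite En ltxx.
have r's : ratio n' x <= s.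
  rewrite leNgt; apply/negP => h.
  have rr : ratio n' x < ratio n1 x :> R by rewrite ltr_pM2r ?invr_gt0// ltr_pM2r// ltr_nat.
  have := @profile_lt_right _ _ _ _ _ prof s (ratio n' x) (ratio n1 x).
  move: l12; rewrite ltr_pM2l//; lra.
have ds' : df rho <= df s by apply: (profile_dhomo prof); lra.
have cs : - df s * (a1%:R * a2%:R) <= - df rho * (a1%:R * a2%:R) by rewrite ler_pM2r// lerN2.
have [||sgA h2] := @crossing_length_bounds s (ratio n' x) x%:R e d X rs ds _ r's e0 Hrho xd.
- by case/andP: r'01.
- lra.
have h1 := top_length_bounds x0 m1a2 E1 e0 H1 xd.
have Q0' : 0 < Q%:R :> R by rewrite ltr0n.
have sgE : Q%:R * (x%:R * (ratio n' x - rho)) = (n' * a2 * Q)%:R - (P * x)%:R.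
  by rewrite !natrM -rhoQ; field; rewrite gt_eqF.
have sgQ : `|(n' * a2 * Q)%:R - (P * x)%:R| <= (Q * (a1 * a2))%:R :> R.
  by rewrite -sgE normrM (gtr0_norm Q0') !natrM ler_pM2l.
move: sgQ; rewrite ler_norml => /andP[q1 q2].
have q1' : (P * x <= n' * a2 * Q + Q * (a1 * a2))%N.
  by rewrite -(ler_nat R) natrD; lra.
(* The integer [Q x (r' - rho)] may be negative; adding its bound [Q a1 a2] makes it a natural
   number. *)
exists (n' * a2 * Q + Q * (a1 * a2) - P * x)%N, m1; split=> //.
  rewrite -(ler_nat R) natrB// natrD [X in _ <= X]natrM; lra.
have -> : limit_gap Q (n' * a2 * Q + Q * (a1 * a2) - P * x)%N m1 =
   df rho * (x%:R * (ratio n' x - rho)) + m1%:R * a1%:R / a2%:R.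
  rewrite /limit_gap natrB// natrD; congr (_ * _ + _).
  transitivity ((Q%:R * (x%:R * (ratio n' x - rho))) / Q%:R); last by field; rewrite !gt_eqF.
  by rewrite sgE; congr (_ / _); ring.
have -> : 2 * e * (a1%:R * a2%:R) = e * (a1%:R * a2%:R) + e * (a1%:R * a2%:R) by ring.
apply: le_trans (lerD h1 h2); rewrite [X in _ <= X + _]distrC.
apply: le_trans (ler_normD _ _); rewrite le_eqVlt; apply/orP; left; apply/eqP.
congr `|_|; ring.
Qed.

(** Both entries of a factorization of [x] are at most [x], so finitely many pairs of factorizations
    occur. *)
Lemma small_gaps_finite (X : nat) :
  finite_set (\bigcup_(x in [set x | (x < X)%N]) Delta_x a1 a2 t x).
Proof.
apply: (@sub_finite_set _ _ ((fun p : (nat * nat) * (nat * nat) =>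
   tnorm t p.1.1%:R p.1.2%:R - tnorm t p.2.1%:R p.2.2%:R) @`
   ((`I_X `*` `I_X) `*` (`I_X `*` `I_X)))); last first.
  by apply: finite_image; do !apply: finite_setX; exact: finite_II.
move=> _ [x /= xX [_ [_ [[[m n] E <-] [[m' n'] E' <-] _ -> _]]]].
have {}E : (m * a1 + n * a2 = x)%N by []; have {}E' : (m' * a1 + n' * a2 = x)%N by [].
have mul_le k a : (0 < a)%N -> (k <= k * a)%N by move=> a0; rewrite leq_pmulr.
have := mul_le m _ a1_gt0; have := mul_le n _ a2_gt0.
have := mul_le m' _ a1_gt0; have := mul_le n' _ a2_gt0.
by move=> h1 h2 h3 h4; exists ((m', n'), (m, n)) => //=; repeat split => /=; lia.
Qed.

(** A subinterval of []a1, c[] free of limit gaps is shrunk to avoid also the gaps of the finitely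
    many small [x]. Density would put a gap there, and [gap_classification] would then place a limit
    gap too close to it. *)
Lemma rational_crossing_not_dense (q : rat) : rho = ratr q ->
  a1%:R < - df rho * (a1%:R * a2%:R) ->
  ~ [set y : R | 0 <= y <= a2%:R] `<=` closure (Delta_S a1 a2 t).
Proof.
move=> rhoq ca1 dense; have [rho01 frho drho _ below] := cross.
have A1' := A1; have A2' := A2; have A0 := A12.
have [P [Q [Q0 rhoQ]]] : exists P Q : nat, (0 < Q)%N /\ rho * Q%:R = P%:R.
  exists `|numq q|%N, `|denq q|%N; rewrite absz_gt0 denq_neq0; split=> //.
  have q0 : 0 <= q by rewrite -(@ler0q R) -rhoq; lra.
  have dq : (denq q)%:~R != 0 :> R by rewrite intr_eq0 denq_neq0.
  rewrite !natr_absz (ger0_norm (ltW (denq_gt0 q))) (ger0_norm (_ : 0 <= numq q)) ?numq_ge0//.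
  by rewrite rhoq /ratr divfK.
have [s rs ds] : exists2 s, rho < s < 1 & df s * (a1%:R * a2%:R) < - a1%:R.
  have eA : 0 < - df rho - a1%:R / (a1%:R * a2%:R).
    by rewrite subr_gt0 ltr_pdivrMr.
  have [d d0 Hd] := @continuous_eps_delta _ _ rho _ (profile_dcont prof) eA.
  have [s s1 sd] : exists2 s, rho < s < 1 & `|s - rho| < d.
    have [dl|dg] := ltP d (1 - rho).
      by exists (rho + d / 2); [lra | rewrite ltr_norml; lra].
    by exists (rho + (1 - rho) / 2); [lra | rewrite ltr_norml; lra].
  exists s => //; have := Hd _ sd; rewrite ltr_norml => /andP[_ h].
  by rewrite -ltr_pdivlMr// mulNr; lra.
pose c := - df s * (a1%:R * a2%:R); have ac : a1%:R < c by rewrite /c; lra.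
have ca2 : c <= a2%:R.
  have : df 0 <= df s by apply: (profile_dhomo prof); lra.
  rewrite (profile_dat0 prof) -(@ler_pM2r _ (a1%:R * a2%:R))// => h.
  have : - a1%:R^-1 * (a1%:R * a2%:R) = - a2%:R :> R by field; rewrite gt_eqF.
  rewrite /c; lra.
have finL : finite_set ((fun p : nat * nat => limit_gap Q p.1 p.2) @`
    (`I_(2 * (Q * (a1 * a2))).+1 `*` `I_a2)).
  by apply: finite_image; apply: finite_setX; exact: finite_II.
have [a [b [aa ab bc Hlim]]] := finite_set_avoid finL ac.
(* A gap in the middle half []w - h, w + h[] of []a, b[] is more than [h] away from the ends, and
   [e] makes the classification error exactly [h]. *)
pose w := (a + b) / 2; pose h := (b - a) / 4; pose e := h / (2 * (a1%:R * a2%:R)).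
have h0 : 0 < h by rewrite /h; lra.
have e0 : 0 < e by rewrite divr_gt0// mulr_gt0.
have eh : 2 * e * (a1%:R * a2%:R) = h by rewrite /e; field; rewrite !gt_eqF.
have [d1 d10 Hd1] := @continuous_eps_delta _ _ rho _ (profile_dcont prof) e0.
have [d2 d20 Hd2] := @continuous_eps_delta _ _ 1 _ (profile_dcont prof) e0.
pose d := Num.min d1 d2; have d0 : 0 < d by rewrite lt_min d10.
have {}Hd1 r : `|r - rho| < d -> `|df r - df rho| < e.
  by rewrite lt_min => /andP[? _]; exact: Hd1.
have {}Hd2 r : `|r - 1| < d -> `|df r - df 1| < e.
  by rewrite lt_min => /andP[_ ?]; exact: Hd2.
have fs : 0 < a2%:R^-1 - f s by rewrite subr_gt0; apply: below; lra.
have rho1 : 0 < 1 - rho by lra.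
have [N1 HN1] := exists_dominating_nat (a1%:R * a2%:R) d0.
have [N2 HN2] := exists_dominating_nat (a1%:R * a2%:R) rho1.
have [N3 HN3] := exists_dominating_nat a1%:R fs.
pose N := (N1 + N2 + N3).+1.
have wh : w - h < w + h by lra.
have [u [v [wu uv vw Hsmall]]] := finite_set_avoid (small_gaps_finite N) wh.
pose z := (u + v) / 2.
have z0a2 : 0 <= z <= a2%:R by rewrite /z /w /h in wu vw *; lra.
have uvz : 0 < (v - u) / 2 by lra.
have [g [Dg]] := dense z z0a2 _ (nbhsx_ballx z _ uvz).
rewrite /ball/= => zg; have {zg}guv : u < g < v.
  by move: zg; rewrite /z ltr_norml; lra.
have [x _ Dx] := Dg; have [xN|Nx] := ltnP x N.
  by apply: (Hsmall g guv); exists x.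
have x0 : (0 < x)%N by exact: leq_trans Nx.
have NN1 : (N1 <= x)%N by apply: leq_trans (leqW _) Nx; rewrite -addnA leq_addr.
have NN2 : (N2 <= x)%N by apply: leq_trans (leqW _) Nx; rewrite addnAC leq_addl.
have NN3 : (N3 <= x)%N by apply: leq_trans (leqW _) Nx; rewrite leq_addl.
have ga1 : a1%:R < g by rewrite /w /h in wu vw; lra.
have gc : g < c by rewrite /w /h in wu vw; lra.
have [k [m [kK ma2 gk]]] := gap_classification x0 Q0 rhoQ rs (ltW ds) e0 Hd1 Hd2
  (HN1 x NN1) (HN2 x NN2) (HN3 x NN3) Dx ga1 gc.
apply: (Hlim (limit_gap Q k m)); last by exists (k, m).
by move: gk; rewrite eh ler_norml; rewrite /w /h in wu vw *; lra.
Qed.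
End Lengths.

(** * Dependence on the exponent *)

Lemma powR_cmp1 (R : realType) (x t : R) : 0 <= x -> 0 < t ->
  ((x `^ t < 1) = (x < 1)) * ((x `^ t == 1) = (x == 1)).
Proof.
move=> x0 t0; have E : 1 `^ t = 1 :> R by rewrite powR1.
have [x1|x1|->] := ltgtP x 1.
- have : x `^ t < 1 by rewrite -[ltRHS]E; apply: gt0_ltr_powR; rewrite ?nnegrE.
  by move=> h; rewrite h; split=> //; apply/lt_eqF.
- have : 1 < x `^ t by rewrite -[ltLHS]E; apply: gt0_ltr_powR; rewrite ?nnegrE.
  by move=> h; rewrite ltNge (ltW h); split=> //; apply/gt_eqF.
- by rewrite E ltxx eqxx.
Qed.

Section Exponent.
Variables (R : realType) (a1 a2 : nat).
Hypotheses (a1_gt0 : (0 < a1)%N) (a12 : (a1 < a2)%N).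

Let a2_gt0 : (0 < a2)%N. Proof. exact: leq_trans a12. Qed.
Let A1 : 0 < a1%:R :> R. Proof. by rewrite ltr0n. Qed.
Let A2 : 0 < a2%:R :> R. Proof. by rewrite ltr0n. Qed.

Lemma length_mu (t : R) : 1 < t -> forall m n x : nat, (0 < x)%N ->
  (m * a1 + n * a2 = x)%N ->
  tnorm t m%:R n%:R = x%:R * mu a1 a2 (n%:R * a2%:R / x%:R) t.
Proof. by move=> t1 m n x x0; apply: tnorm_mu => //; apply: lt_trans t1. Qed.

(* The equation mu = 1 / a2 raised to the power t, so that it reads level = 1. *)
Definition level (r t : R) : R := (a2%:R * ((1 - r) / a1%:R)) `^ t + r `^ t.

Lemma level_cmp1 (r t : R) : 0 <= r <= 1 -> 0 < t ->
  ((level r t < 1) = (mu a1 a2 r t < a2%:R^-1)) *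
  ((level r t == 1) = (mu a1 a2 r t == a2%:R^-1)).
Proof.
move=> /andP[r0 r1] t0.
have s0 : 0 <= a2%:R * ((1 - r) / a1%:R).
  by rewrite mulr_ge0 ?divr_ge0 ?subr_ge0// ltW.
have N0 : 0 <= tnorm t (a2%:R * ((1 - r) / a1%:R)) r by rewrite powR_ge0.
have -> : level r t = (tnorm t (a2%:R * ((1 - r) / a1%:R)) r) `^ t.
  by rewrite tnorm_powR// !ger0_norm.
rewrite !(powR_cmp1 N0 t0).
have -> : tnorm t (a2%:R * ((1 - r) / a1%:R)) r = a2%:R * mu a1 a2 r t.
  transitivity (tnorm t (a2%:R * ((1 - r) / a1%:R)) (a2%:R * (r / a2%:R))).
    by congr (tnorm t _ _); rewrite mulrC divfK// gt_eqF.
  by apply: tnormZ => //; apply: ltW.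
move: (mu a1 a2 r t) => m; have A2n : a2%:R != 0 :> R by rewrite gt_eqF.
split; last by rewrite -[RHS](inj_eq (mulfI A2n)) mulfV.
by rewrite -[RHS](ltr_pM2l A2) mulfV.
Qed.

Lemma level_continuous (r : R) : 0 < r < 1 -> continuous (level r).
Proof.
move=> /andP[r0 r1]; have pc (b : R) : 0 < b -> continuous (fun t => b `^ t).
  move=> b0; have -> : (fun t => b `^ t) = (fun t => expR (t * ln b)).
    by apply/funext => t; rewrite /powR gt_eqF.
  move=> t; apply: (@continuous_comp _ _ _ (fun t : R => t * ln b) expR).
    by apply: cvgMr_tmp.
  exact: continuous_expR.
move=> t; apply: cvgD; first by apply: pc; rewrite mulr_gt0// divr_gt0// subr_gt0.
exact: pc.
Qed.

Lemma level_base (r t : R) : 0 < r < 1 -> 0 < t -> mu a1 a2 r t = a2%:R^-1 ->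
  (a2%:R * ((1 - r) / a1%:R)) `^ t + r `^ t = 1 /\
  0 < a2%:R * ((1 - r) / a1%:R) < 1.
Proof.
move=> /andP[r0 r1] t0 mr; have r01 : 0 <= r <= 1 by rewrite !ltW.
have lE : level r t = 1 by apply/eqP; rewrite (level_cmp1 r01 t0) mr.
have s0 : 0 < a2%:R * ((1 - r) / a1%:R) by rewrite mulr_gt0// divr_gt0// subr_gt0.
split; first exact: lE.
by rewrite s0/= -(powR_cmp1 (ltW s0) t0) -[ltRHS]lE /level ltrDl powR_gt0.
Qed.

(** At the crossing for [t] both bases in [level] lie in []0, 1[], so a larger exponent brings the
    sum below 1, which happens only to the right of the new crossing. *)
Lemma r0_decreasing (t t' : R) : 1 < t -> t < t' -> r0 a1 a2 t' < r0 a1 a2 t.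
Proof.
move=> t1 tt'; have t'1 : 1 < t' by exact: lt_trans tt'.
have t0 : 0 < t by exact: lt_trans t1.
have t'0 : 0 < t' by exact: lt_trans t'1.
have cr := r0_crossing a1_gt0 a12 t1; have cr' := r0_crossing a1_gt0 a12 t'1.
move: (r0 a1 a2 t) (r0 a1 a2 t') cr cr' => rho rho' cr cr'.
have /andP[rho0 rho1] := crossing_itv cr.
have [lE /andP[s0 s1]] := level_base (crossing_itv cr) t0 (crossing_eq cr).
have lt' : mu a1 a2 rho t' < a2%:R^-1.
  rewrite -level_cmp1 ?ltW// -[ltRHS]lE; apply: ler_ltD.
    by apply: ger_powR; rewrite ?s0 ?ltW.
  have -> : t' = t + (t' - t) by ring.
  rewrite powRD; last by rewrite (gt_eqF rho0) implybT.
  by rewrite -[ltRHS]mulr1 ltr_pM2l ?powR_gt0// powR_cmp1 ?subr_gt0// ltW.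
rewrite ltNge; apply/negP; rewrite le_eqVlt => /predU1P[E|h].
  by move: lt'; rewrite E (crossing_eq cr') ltxx.
by have := lt_trans (crossing_gt cr' (ltW rho0) h) lt'; rewrite ltxx.
Qed.

Lemma r0_injective : {in [set t : R | 1 < t] &, injective (r0 a1 a2)}.
Proof.
move=> t t'; rewrite !inE /= => t1 t'1 E; have [h|h|//] := ltgtP t t'.
- by have := r0_decreasing t1 h; rewrite E ltxx.
- by have := r0_decreasing t'1 h; rewrite E ltxx.
Qed.

(** The quantity is [a2 p' - a1 q'], where [p'] and [q'] are the two terms of [level] with exponent
    [t - 1], so [p' + q'] is at least 1. Hence it exceeds [a1] once [q'] is below
    [b = (a2 - a1) / (a1 + a2)]. *)
Lemma steep_crossing : exists2 T : R, 1 < T & forall t, T < t ->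
  a1%:R < - dmu a1 a2 t (r0 a1 a2 t) * (a1%:R * a2%:R).
Proof.
have lt12 : 1 < 2 :> R by rewrite ltr1n.
have sgP := crossing_itv (r0_crossing a1_gt0 a12 lt12).
have [sg sgE] : exists sg, sg = r0 a1 a2 2 :> R by exists (r0 a1 a2 2).
rewrite -sgE in sgP; pose b : R := (a2%:R - a1%:R) / (a1%:R + a2%:R).
have b0 : 0 < b by apply: divr_gt0; [rewrite subr_gt0 ltr_nat | rewrite addr_gt0].
have [n sgn] : exists n, sg ^+ n < b.
  have /cvgrPdist_lt/(_ _ b0) : (sg ^+ n : R) @[n --> \oo] --> 0.
    by apply: cvg_expr; case/andP: sgP => h1 h2; rewrite gtr0_norm.
  move=> [n _ H]; exists n; have := H n (leqnn n).
  by rewrite /= sub0r normrN ger0_norm// exprn_ge0//; case/andP: sgP => /ltW.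
have n0 : 0 <= n%:R :> R by [].
(* The 2 gives [rho < sg] by monotonicity and leaves [t - 1] above [n], whence [q'] is at most
   [sg ^+ n < b]. *)
exists (n%:R + 2); first by rewrite ltr_wpDl.
move=> t nt.
have t2 : 2 < t by apply: le_lt_trans nt; rewrite lerDr.
have t1 : 1 < t by exact: lt_trans t2.
have t0 : 0 < t by exact: lt_trans t1.
have cr := r0_crossing a1_gt0 a12 t1.
have rsg := r0_decreasing lt12 t2; rewrite -sgE in rsg.
move: (r0 a1 a2 t) cr rsg => rho cr rsg.
have /andP[rho0 rho1] := crossing_itv cr.
have [lE /andP[s0 s1]] := level_base (crossing_itv cr) t0 (crossing_eq cr).
have -> : - dmu a1 a2 t rho * (a1%:R * a2%:R) =
    a2%:R * (a2%:R * ((1 - rho) / a1%:R)) `^ (t - 1) - a1%:R * rho `^ (t - 1).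
  rewrite /dmu (crossing_eq cr) invrK [rho / _ * _]divfK ?gt_eqF//.
  rewrite [(1 - rho) / _ * _]mulrC (gtr0_norm rho0) (gtr0_norm s0).
  by move: (_ `^ _) (rho `^ _) => p q; field; rewrite !gt_eqF.
have tt : t - 1 <= t by rewrite gerBl.
have st : (a2%:R * ((1 - rho) / a1%:R)) `^ t <= (a2%:R * ((1 - rho) / a1%:R)) `^ (t - 1).
  by apply: ger_powR => //; rewrite s0 ltW.
have rt : rho `^ t <= rho `^ (t - 1) by apply: ger_powR => //; rewrite rho0 ltW.
have rb : rho `^ (t - 1) < b.
  apply: le_lt_trans sgn; apply: (@le_trans _ _ (rho `^ n%:R)).
    apply: ger_powR; first by rewrite rho0 ltW.
    by rewrite lerBrDr; apply: ltW; apply: le_lt_trans nt; rewrite lerD2l ler1n.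
  rewrite powR_mulrn; last exact: ltW.
  by apply: lerXn2r; rewrite ?nnegrE ltW//; exact: lt_trans rsg.
move: rb; rewrite ltr_pdivlMr ?addr_gt0//.
move: lE st rt; move: (_ `^ t) (rho `^ t) (_ `^ (t - 1)) (rho `^ (t - 1)).
move=> p q p' q' lE st rt rb.
have : a2%:R * (1 - q') <= a2%:R * p' by rewrite ler_pM2l//; lra.
lra.
Qed.

(** For a rational [q] between the values of [r0] at [u] and at [t], [level q] is above 1 at [t] and
    below 1 at [u]. An exponent where it equals 1 has its crossing at [q] by uniqueness. *)
Lemma rational_r0_dense (t e : R) : 1 < t -> 0 < e ->
  exists t', [/\ t < t', t' < t + e & exists q : rat, r0 a1 a2 t' = ratr q].
Proof.
move=> t1 e0; pose u := t + e / 2; have tu : t < u by rewrite /u; lra.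
have u1 : 1 < u by exact: lt_trans tu.
have [q] := rat_in_itvoo (r0_decreasing t1 tu); rewrite in_itv/= => /andP[uq qt].
have cr := r0_crossing a1_gt0 a12 t1; have cru := r0_crossing a1_gt0 a12 u1.
have t0 : 0 < t by exact: lt_trans t1.
have u0 : 0 < u by exact: lt_trans u1.
have q0 : 0 < (ratr q : R).
  by apply: lt_trans uq; case/andP: (crossing_itv cru).
have q1 : (ratr q : R) < 1.
  by apply: lt_trans qt _; case/andP: (crossing_itv cr).
have q01 : 0 <= (ratr q : R) <= 1 by rewrite !ltW.
have lu : level (ratr q) u < 1 by rewrite (level_cmp1 q01 u0); exact: crossing_lt cru _ _ _.
have lt' : 1 < level (ratr q) t.
  have h := crossing_gt cr (ltW q0) qt.
  by rewrite ltNge le_eqVlt !(level_cmp1 q01 t0) (gt_eqF h) (lt_gtF h).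
have [||| t'] := @IVT R (level (ratr q)) t u 1.
- exact: ltW.
- by apply: continuous_subspaceT; apply: level_continuous; rewrite q0.
- by rewrite ge_min le_max (ltW lu) (ltW lt') orbT.
rewrite in_itv/= => /andP[tt' t'u] lE.
have t't : t < t'.
  by rewrite lt_neqAle tt' andbT; apply/eqP => E; move: lt'; rewrite E lE ltxx.
have t'1 : 1 < t' by exact: lt_trans t't.
have t'0 : 0 < t' by exact: lt_trans t'1.
exists t'; split=> //.
  by apply: le_lt_trans t'u _; rewrite /u ltrD2l gtr_pMr// invf_lt1 ?ltr1n.
exists q; apply/esym; apply: (crossing_unique (r0_crossing a1_gt0 a12 t'1)) => //; first exact: ltW.
by apply/eqP; rewrite -(level_cmp1 q01 t'0) lE.
Qed.

End Exponent.

(** * Rationality, countability and density of the perspicacious parameters *)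

Theorem theorem1 (R : realType) (a1 a2 : nat) :
  (1 < a1)%N -> (a1 < a2)%N -> coprime a1 a2 ->
  let P := [set t : R | perspicacious a1 a2 t] in
  [/\ (forall t, P t -> exists q : rat, r0 a1 a2 t = ratr q),
      countable P &
      exists T : R, [set t : R | T < t] `<=` closure P].
Proof.
move=> a1_gt1 a12 co P; have a1_gt0 := ltnW a1_gt1.
have a2_gt0 : (0 < a2)%N by exact: leq_trans a12.
have Prat t : P t -> exists q : rat, r0 a1 a2 t = ratr q.
  move=> [t1 ndense]; have [|irr] := pselect (rational (r0 a1 a2 t)).
    by move=> [q _ <-]; exists q.
  exfalso; apply: ndense; exact: (irrational_crossing_dense a1_gt0 a12 co
    (mu_profile a1_gt0 a2_gt0 t1) (r0_crossing a1_gt0 a12 t1)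
    (length_mu a1_gt0 a12 t1) irr).
split=> //.
(* [F] is injective on [P] because [r0] is; outside [P] its value 0 is arbitrary. *)
- have /choice[F HF] : forall t : R, exists q : rat, P t -> r0 a1 a2 t = ratr q.
    move=> t; have [/Prat[q Eq]|nP] := pselect (P t); first by exists q.
    by exists 0 => /nP.
  apply/countable_injP; exists (pickle \o F) => t t' /set_mem Pt /set_mem Pt'.
  move=> /= /(pcan_inj pickleK) FF.
  have [t1 t'1] : 1 < t /\ 1 < t' by split; [case: Pt | case: Pt'].
  apply: (r0_injective a1_gt0 a12) (mem_set t1) (mem_set t'1) _.
  by rewrite (HF _ Pt) (HF _ Pt') FF.
- have [T T1 HT] := @steep_crossing R a1 a2 a1_gt0 a12.
  exists T => t /= Tt B /nbhs_normP[e /= e0 He].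
  have t1 : 1 < t by exact: lt_trans Tt.
  have [t' [tt' t'e [q Eq]]] := rational_r0_dense a1_gt0 a12 t1 e0.
  have t'1 : 1 < t' by exact: lt_trans tt'.
  exists t'; split; last by apply: He; rewrite /= distrC gtr0_norm; lra.
  split=> //; apply: (rational_crossing_not_dense a1_gt0 a12 co
    (mu_profile a1_gt0 a2_gt0 t'1) (r0_crossing a1_gt0 a12 t'1)
    (length_mu a1_gt0 a12 t'1) Eq).
  by apply: HT; exact: lt_trans tt'.
Qed.
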